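(* Let $\mathbb A_1,\mathbb A_2,\mathbb B_1,\mathbb B_2$ be homogeneous polycomplexes in a $(G,\mu)$-graded-monoidal category $\mathcal C$, with $\mu$ symmetric. If $\mathbb A_1\simeq\mathbb B_1$ and $\mathbb A_2\simeq\mathbb B_2$, then $$\mathbb A_1\otimes\mathbb A_2\;\simeq\;\mathbb B_1\otimes\mathbb B_2,$$ where $\simeq$ denotes homotopy equivalence and $\otimes$ is the tensor product of homogeneous polycomplexes defined by the graded Koszul rule.
   Context: **Graded-monoidal categories.** $G$ is an abelian group, $\Bbbk$ a unital commutative ring, $\mu\colon G\times G\to\Bbbk^\times$ a $\mathbb Z$-bilinear map, written $g*h:=\mu(g,h)$, which is symmetric in the sense that $\mu(g,h)\mu(h,g)=1$ for all $g,h$. A $(G,\mu)$-graded-monoidal category $\mathcal C$ is a category whose Homs are $G$-graded $\Bbbk$-modules with bilinear, degree-additive composition, together with a unit object and a strictly associative and unital tensor product on objects and morphisms, bilinear and degree-additive on morphisms, preserving identities, and satisfying $(f\otimes g)\circ(h\otimes k)=\mu(\deg g,\deg h)(f\circ h)\otimes(g\circ k)$ for homogeneous morphisms (extended additively). The zero morphism is homogeneous but has no well-defined degree. **Homogeneous polycomplexes.** Let $\mathcal I$ be a finite ordered set with $n$ elements, $\mathbf e_i$ ($i\in\mathcal I$) the canonical basis of $\mathbb Z^{\mathcal I}$, $|\mathbf r|=\sum_i r_i$. A homogeneous $n$-polycomplex $\mathbb A=(A,\alpha,\psi_{\mathbb A})$ consists of objects $A^{\mathbf r}$, $\mathbf r\in\mathbb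 Z^{\mathcal I}$; homogeneous morphisms $\alpha_i^{\mathbf r}\colon A^{\mathbf r}\to A^{\mathbf r+\mathbf e_i}$ with $\alpha_i^{\mathbf r+\mathbf e_i}\circ\alpha_i^{\mathbf r}=0$ and $\alpha_j^{\mathbf r+\mathbf e_i}\circ\alpha_i^{\mathbf r}=-\alpha_i^{\mathbf r+\mathbf e_j}\circ\alpha_j^{\mathbf r}$ for $i\neq j$; and a $G$-valued 1-cocycle $\psi_{\mathbb A}$ on the lattice graph $\mathbb Z^{\mathcal I}$ (a function on oriented edges whose sum over every cycle is zero) such that $\psi_{\mathbb A}(\mathbf r\to\mathbf r+\mathbf e_i)=\deg\alpha_i^{\mathbf r}$ whenever $\alpha_i^{\mathbf r}\ne0$. Let $|\alpha|(\mathbf r)\in G$ be the value of $\psi_{\mathbb A}$ on any path from $\mathbf 0$ to $\mathbf r$. The total complex $\mathrm{Tot}(\mathbb A)$ has $\mathrm{Tot}(\mathbb A)_t=\bigoplus_{|\mathbf r|=t}A^{\mathbf r}$ (formal direct sum; morphisms between such sums are matrices with finitely many nonzero entries in each column) and differential $\sum_i\alpha_i^{\mathbf r}$ on $A^{\mathbf r}$. Chain maps, chain homotopies and homotopy equivalences between homogeneous polycomplexes are the usual ones between total complexes; their components $A^{\mathbf r}\to B^{\mathbf s}$ are arbitrary (not necessarily homogeneous) morphisms of $\mathcal C$. **Tensor product.** For $\mathbb A$ over $\mathcal I$ and $\mathbb B=(B,\beta,\psi_{\mathbb B})$ over $\mathcal J$, $\mathbb A\otimes\mathbb B$ is the homogeneous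 polycomplex over $\mathcal I\sqcup\mathcal J$ (elements of $\mathcal I$ before those of $\mathcal J$) with objects $A^{\mathbf r}\otimes B^{\mathbf s}$, with morphisms $\alpha_i^{\mathbf r}\otimes\mathrm{id}_{B^{\mathbf s}}$ in direction $i\in\mathcal I$ and $(-1)^{|\mathbf r|}\big(|\alpha|(\mathbf r)*\psi_{\mathbb B}(\mathbf s\to\mathbf s+\mathbf e_j)\big)\,\mathrm{id}_{A^{\mathbf r}}\otimes\beta_j^{\mathbf s}$ in direction $j\in\mathcal J$, and with 1-cocycle equal to $\psi_{\mathbb A}(\mathbf r\to\mathbf r+\mathbf e_i)$, resp. $\psi_{\mathbb B}(\mathbf s\to\mathbf s+\mathbf e_j)$, on the corresponding edges. *)

(* Defs.v *)
From HB Require Import structures.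
From mathcomp Require Import all_boot all_order all_algebra.
From mathcomp Require Import all_classical.

Set Implicit Arguments.
Unset Strict Implicit.
Unset Printing Implicit Defensive.

Import Order.TTheory GRing.Theory.
Local Open Scope classical_set_scope.
Local Open Scope ring_scope.

(* The symmetry axiom exhibits mu h g as an inverse of mu g h, so that mu takes
   values in the units of k; bilinearity is from (G, +) to (units of k, * ). *)
Record sym_bichar (G : zmodType) (k : comPzRingType) := SymBichar {
  bichar_fun :> G -> G -> k;
  bicharDl : forall g g' h,
    bichar_fun (g + g') h = bichar_fun g h * bichar_fun g' h;
  bicharDr : forall g h h',
    bichar_fun g (h + h') = bichar_fun g h * bichar_fun g h';
  bichar_sym : forall g h, bichar_fun g h * bichar_fun h g = 1
}.

(* The module M is the internal direct sum of the submodules D g. *)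
Record is_grading (G : zmodType) (k : comPzRingType) (M : lmodType k)
    (D : G -> set M) : Prop := IsGrading {
  grading0 : forall g, D g 0;
  gradingP : forall g (a : k) x y, D g x -> D g y -> D g (a *: x + y);
  grading_span : forall x, exists (s : seq G) (c : G -> M),
    [/\ uniq s, forall g, D g (c g) & x = \sum_(g <- s) c g];
  grading_free : forall (s : seq G) (c : G -> M), uniq s ->
    (forall g, D g (c g)) -> \sum_(g <- s) c g = 0 ->
    forall g, g \in s -> c g = 0
}.

(* Identification of Hom-modules along equalities of objects; needed because
   strictness of the tensor product is an equality between objects. *)
Definition hom_cast (k : pzRingType) (O : Type) (H : O -> O -> lmodType k)
    (x x' y y' : O) (ex : x = x') (ey : y = y') (f : H x y) : H x' y' :=
  match ex in _ = u, ey in _ = v return H u v with erefl, erefl => f end.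
Arguments hom_cast : simpl never.

(* homdeg g is the degree g part of a Hom-module.  A morphism is homogeneous
   when it lies in some homdeg g; zero lies in all of them. *)
Record gmcat (G : zmodType) (k : comPzRingType) (mu : sym_bichar G k) :=
    GMCat {
  gm_ob :> Type;
  hom : gm_ob -> gm_ob -> lmodType k;
  homdeg : forall x y, G -> set (hom x y);
  hom_grading : forall x y, is_grading (@homdeg x y);

  gm_id : forall x, hom x x;
  gm_comp : forall x y z, hom y z -> hom x y -> hom x z;
  gm_compA : forall x y z t (f : hom z t) (g : hom y z) (h : hom x y),
    gm_comp f (gm_comp g h) = gm_comp (gm_comp f g) h;
  gm_comp1l : forall x y (f : hom x y), gm_comp (gm_id y) f = f;
  gm_comp1r : forall x y (f : hom x y), gm_comp f (gm_id x) = f;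
  gm_compPl : forall x y z (a : k) (f f' : hom y z) (g : hom x y),
    gm_comp (a *: f + f') g = a *: gm_comp f g + gm_comp f' g;
  gm_compPr : forall x y z (a : k) (f : hom y z) (g g' : hom x y),
    gm_comp f (a *: g + g') = a *: gm_comp f g + gm_comp f g';
  gm_comp_deg : forall x y z a b (f : hom y z) (g : hom x y),
    homdeg a f -> homdeg b g -> homdeg (a + b) (gm_comp f g);

  gm_one : gm_ob;
  gm_tens : gm_ob -> gm_ob -> gm_ob;
  gm_tensm : forall x x' y y',
    hom x x' -> hom y y' -> hom (gm_tens x y) (gm_tens x' y');
  gm_tensPl : forall x x' y y' (a : k) (f f' : hom x x') (g : hom y y'),
    gm_tensm (a *: f + f') g = a *: gm_tensm f g + gm_tensm f' g;
  gm_tensPr : forall x x' y y' (a : k) (f : hom x x') (g g' : hom y y'),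
    gm_tensm f (a *: g + g') = a *: gm_tensm f g + gm_tensm f g';
  gm_tens_deg : forall x x' y y' a b (f : hom x x') (g : hom y y'),
    homdeg a f -> homdeg b g -> homdeg (a + b) (gm_tensm f g);
  gm_tens_id : forall x y, gm_tensm (gm_id x) (gm_id y) = gm_id (gm_tens x y);
  gm_interchange : forall x x' x'' y y' y'' a b c d
      (f : hom x' x'') (g : hom y' y'') (h : hom x x') (l : hom y y'),
    homdeg a f -> homdeg b g -> homdeg c h -> homdeg d l ->
    gm_comp (gm_tensm f g) (gm_tensm h l)
      = mu b c *: gm_tensm (gm_comp f h) (gm_comp g l);

  gm_tensA : forall x y z, gm_tens (gm_tens x y) z = gm_tens x (gm_tens y z);
  gm_tens1l : forall x, gm_tens gm_one x = x;
  gm_tens1r : forall x, gm_tens x gm_one = x;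
  gm_tensmA : forall x x' y y' z z'
      (f : hom x x') (g : hom y y') (h : hom z z'),
    hom_cast (gm_tensA x y z) (gm_tensA x' y' z') (gm_tensm (gm_tensm f g) h)
      = gm_tensm f (gm_tensm g h);
  gm_tensm1l : forall x x' (f : hom x x'),
    hom_cast (gm_tens1l x) (gm_tens1l x') (gm_tensm (gm_id gm_one) f) = f;
  gm_tensm1r : forall x x' (f : hom x x'),
    hom_cast (gm_tens1r x) (gm_tens1r x') (gm_tensm f (gm_id gm_one)) = f
}.

Declare Scope gmcat_scope.
Delimit Scope gmcat_scope with GM.
Local Open Scope gmcat_scope.
Notation "f \oc g" := (gm_comp f g)
  (at level 40, left associativity) : gmcat_scope.
Notation "x \ot y" := (gm_tens x y)
  (at level 40, left associativity) : gmcat_scope.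
Notation "f \om g" := (gm_tensm f g)
  (at level 40, left associativity) : gmcat_scope.

Section GMCatTheory.
Variables (G : zmodType) (k : comPzRingType) (mu : sym_bichar G k).
Variable C : gmcat mu.
Implicit Types x y z t : C.

Lemma bichar0l h : mu 0 h = 1.
Proof.
have := bicharDl mu 0 0 h; rewrite addr0 => /(congr1 ( *%R^~ (mu h 0))).
by rewrite -mulrA bichar_sym mulr1 => ->.
Qed.

Lemma bichar0r h : mu h 0 = 1.
Proof. by rewrite -[LHS]mulr1 -{1}(bichar0l h) bichar_sym. Qed.

Lemma homdeg0 x y g : homdeg g (0 : hom x y).
Proof. exact: (grading0 (hom_grading x y)). Qed.

Lemma homdegZ x y g a (f : hom x y) : homdeg g f -> homdeg g (a *: f).
Proof.
move=> fg; rewrite -[_ *: _]addr0.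
exact: (gradingP (hom_grading x y)) (homdeg0 _ _ _).
Qed.

Lemma compDl x y z (f f' : hom y z) (g : hom x y) :
  (f + f') \oc g = f \oc g + f' \oc g.
Proof. by have := gm_compPl 1 f f' g; rewrite !scale1r. Qed.

Lemma compDr x y z (f : hom y z) (g g' : hom x y) :
  f \oc (g + g') = f \oc g + f \oc g'.
Proof. by have := gm_compPr 1 f g g'; rewrite !scale1r. Qed.

Lemma comp0l x y z (g : hom x y) : (0 : hom y z) \oc g = 0.
Proof. by apply: (addrI (0 \oc g)); rewrite -compDl !addr0. Qed.

Lemma comp0r x y z (f : hom y z) : f \oc (0 : hom x y) = 0.
Proof. by apply: (addrI (f \oc 0)); rewrite -compDr !addr0. Qed.

Lemma compZl x y z a (f : hom y z) (g : hom x y) :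
  (a *: f) \oc g = a *: (f \oc g).
Proof. by rewrite -[a *: f]addr0 gm_compPl comp0l addr0. Qed.

Lemma compZr x y z a (f : hom y z) (g : hom x y) :
  f \oc (a *: g) = a *: (f \oc g).
Proof. by rewrite -[a *: g]addr0 gm_compPr comp0r addr0. Qed.

Lemma comp_suml x y z T (s : seq T) (F : T -> hom y z) (g : hom x y) :
  (\sum_(i <- s) F i) \oc g = \sum_(i <- s) F i \oc g.
Proof.
exact: (big_morph (fun f => f \oc g) (fun f f' => compDl f f' g)
  (comp0l _ g)).
Qed.

Lemma comp_sumr x y z T (s : seq T) (F : T -> hom x y) (f : hom y z) :
  f \oc (\sum_(i <- s) F i) = \sum_(i <- s) f \oc F i.
Proof.
exact: (big_morph (gm_comp f) (compDr f) (comp0r _ f)).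
Qed.

Lemma tensDl x x' y y' (f f' : hom x x') (g : hom y y') :
  (f + f') \om g = f \om g + f' \om g.
Proof. by have := gm_tensPl 1 f f' g; rewrite !scale1r. Qed.

Lemma tensDr x x' y y' (f : hom x x') (g g' : hom y y') :
  f \om (g + g') = f \om g + f \om g'.
Proof. by have := gm_tensPr 1 f g g'; rewrite !scale1r. Qed.

Lemma tens0l x x' y y' (g : hom y y') : (0 : hom x x') \om g = 0.
Proof. by apply: (addrI (0 \om g)); rewrite -tensDl !addr0. Qed.

Lemma tens0r x x' y y' (f : hom x x') : f \om (0 : hom y y') = 0.
Proof. by apply: (addrI (f \om 0)); rewrite -tensDr !addr0. Qed.


Lemma tensNl x x' y y' (f : hom x x') (g : hom y y') :
  (- f) \om g = - (f \om g).
Proof. by apply: (addIr (f \om g)); rewrite -tensDl !addNr tens0l. Qed.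

Lemma tensNr x x' y y' (f : hom x x') (g : hom y y') :
  f \om (- g) = - (f \om g).
Proof. by apply: (addIr (f \om g)); rewrite -tensDr !addNr tens0r. Qed.

Lemma homdegB x y g (f f' : hom x y) :
  homdeg g f -> homdeg g f' -> homdeg g (f - f').
Proof.
move=> fg f'g; rewrite addrC -scaleN1r.
exact: (gradingP (hom_grading x y)).
Qed.

Lemma homdeg_id x : homdeg 0 (gm_id x).
Proof.
have [s [c [us s0 Dc E]]] : exists (s : seq G) (c : G -> hom x x),
    [/\ uniq s, 0 \in s, forall g, homdeg g (c g) &
        gm_id x = \sum_(g <- s) c g].
  have [s [c [us Dc E]]] := grading_span (hom_grading x x) (gm_id x).
  have [s0|s0] := boolP (0 \in s); first by exists s, c.
  exists (0 :: s), (fun g => if g == 0 then 0 else c g).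
  rewrite big_cons eqxx add0r /= s0 us mem_head; split=> // [g|].
    by case: ifP => _ //; apply: homdeg0.
  rewrite E; apply: eq_big_seq => g sg; case: eqP => // g0.
  by rewrite g0 (negPf s0) in sg.
have idr g (f : hom x x) : homdeg g f -> f \oc c 0 = f.
  move=> fg; pose F u := f \oc c (u - g) - (if u == g then f else 0).
  have sF : \sum_(u <- [seq h + g | h <- s]) F u = 0.
    rewrite big_map (eq_bigr (fun h => f \oc c h - (if h == 0 then f else 0))).
      rewrite sumrB -comp_sumr -E gm_comp1r -big_mkcond.
      by rewrite -big_filter filter_pred1_uniq // big_seq1 subrr.
    by move=> h _; rewrite /F addrK -{2}[g]add0r (inj_eq (addIr g)).
  have := grading_free (hom_grading x x) _ _ sF; rewrite /F => /(_ _ _ g).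
  rewrite subrr eqxx => F0; apply/eqP; rewrite -subr_eq0; apply/eqP.
  apply: F0; first by rewrite map_inj_uniq //; apply: addIr.
    move=> u; apply: homdegB.
      by have := gm_comp_deg fg (Dc (u - g)); rewrite addrC subrK.
    by case: eqP => [->//|_]; apply: homdeg0.
  by apply/mapP; exists 0; rewrite ?add0r.
suff -> : gm_id x = c 0 by [].
rewrite -(gm_comp1l (c 0)) {2}E comp_suml [LHS]E.
by apply: eq_bigr => g _; rewrite (idr g).
Qed.

End GMCatTheory.

(* A formal direct sum of objects of C, with an integer weight attached to each
   summand; the summands of weight t make up its component in degree t. *)
Section Complexes.
Variables (G : zmodType) (k : comPzRingType) (mu : sym_bichar G k).
Variable C : gmcat mu.

Record gsum := GSum {
  gs_ix : choiceType;
  gs_wt : gs_ix -> int;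
  gs_ob : gs_ix -> C
}.

Definition gmx (X Y : gsum) :=
  forall (x : gs_ix X) (y : gs_ix Y), hom (gs_ob x) (gs_ob y).

(* The matrix f is a morphism of degree n: its columns f x are finite and it
   sends the component in degree t to the component in degree t + n. *)
Definition is_gmor (X Y : gsum) (n : int) (f : gmx X Y) :=
  (forall x, finite_set [set y | f x y != 0]) /\
  (forall x y, f x y != 0 -> gs_wt y = gs_wt x + n).

(* The sum has finitely many nonzero terms as soon as the columns of g are
   finite; \sum_(_ \in _) is 0 by convention on infinite supports. *)
Definition gmx_comp (X Y Z : gsum) (f : gmx Y Z) (g : gmx X Y) : gmx X Z :=
  fun x z => \sum_(y \in [set: gs_ix Y]) f y z \oc g x y.

Definition gmx_id (X : gsum) : gmx X X := fun x y =>
  if x =P y is ReflectT e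
  then hom_cast erefl (congr1 (@gs_ob X) e) (gm_id (gs_ob x)) else 0.

Record complex := Complex {
  cx_gsum :> gsum;
  cx_d : gmx cx_gsum cx_gsum;
  cx_d_gmor : is_gmor 1 cx_d;
  cx_dd : forall x z, gmx_comp cx_d cx_d x z = 0
}.

Definition chain_map (X Y : complex) (f : gmx X Y) :=
  is_gmor 0 f /\
  forall x y, gmx_comp (@cx_d Y) f x y = gmx_comp f (@cx_d X) x y.

Definition homotopic (X Y : complex) (f g : gmx X Y) :=
  exists2 h : gmx X Y, is_gmor (-1) h &
    forall x y, f x y - g x y
      = gmx_comp (@cx_d Y) h x y + gmx_comp h (@cx_d X) x y.

Definition homotopy_equivalent (X Y : complex) :=
  exists (f : gmx X Y) (g : gmx Y X),
    [/\ chain_map f, chain_map g,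
        homotopic (gmx_comp g f) (@gmx_id X) &
        homotopic (gmx_comp f g) (@gmx_id Y)].

End Complexes.

(* Ordinal sum of two finite ordered sets: the disjoint union, with the
   elements of I before those of J. *)
Definition ordsum (I J : Type) : Type := (I + J)%type.

Section OrdSum.
Variables (d d' : Order.disp_t) (I : finOrderType d) (J : finOrderType d').

Definition ordsum_le (x y : ordsum I J) : bool :=
  match x, y with
  | inl i, inl i' => (i <= i')%O
  | inl _, inr _ => true
  | inr _, inl _ => false
  | inr j, inr j' => (j <= j')%O
  end.

Lemma ordsum_le_refl : reflexive ordsum_le.
Proof. by case=> i /=. Qed.

Lemma ordsum_le_anti : antisymmetric ordsum_le.
Proof. by case=> i [] j //= /le_anti ->. Qed.

Lemma ordsum_le_trans : transitive ordsum_le.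
Proof. by case=> y [] x [] z //=; apply: le_trans. Qed.

Lemma ordsum_le_total : total ordsum_le.
Proof. by case=> x [] y //=; apply: le_total. Qed.

HB.instance Definition _ := Finite.copy (ordsum I J) (I + J)%type.
HB.instance Definition _ := Order.Le_isPOrder.Build Order.default_display
  (ordsum I J) ordsum_le_refl ordsum_le_anti ordsum_le_trans.
HB.instance Definition _ := Order.POrder_isTotal.Build Order.default_display
  (ordsum I J) ordsum_le_total.
End OrdSum.

Notation lattice I := {ffun I -> int}.

Section Lattice.
Variables (I : finType) (G : zmodType).
Implicit Types (r s : lattice I) (p : seq (lattice I)).

Definition unitv (i : I) : lattice I := [ffun j => (j == i)%:R].

Definition weight r : int := \sum_i r i.

Definition adjacent : rel (lattice I) :=
  fun r s => [exists i, (s == r + unitv i) || (r == s + unitv i)].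

(* psi r s is the value of a function psi on the oriented edge r -> s; its
   values on non-adjacent pairs are irrelevant. *)
Fixpoint walk_sum (psi : lattice I -> lattice I -> G) r p : G :=
  if p is s :: p' then psi r s + walk_sum psi s p' else 0.

Definition is_cocycle (psi : lattice I -> lattice I -> G) :=
  forall r p, path adjacent r p -> last r p = r -> walk_sum psi r p = 0.

Lemma weightD r s : weight (r + s) = weight r + weight s.
Proof. by rewrite /weight -big_split; apply: eq_bigr => i _; rewrite ffunE. Qed.

Lemma weight_unitv i : weight (unitv i) = 1.
Proof.
rewrite /weight (bigD1 i) //= ffunE eqxx big1 ?addr0 // => j /negPf ji.
by rewrite ffunE ji.
Qed.

Lemma unitv_inj : injective unitv.
Proof.
by move=> i j /ffunP/(_ i); rewrite !ffunE eqxx; case: eqP.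
Qed.

Lemma adjacentC r s : adjacent r s = adjacent s r.
Proof. by apply: eq_existsb => i; rewrite orbC. Qed.

Lemma adjacentD r i : adjacent r (r + unitv i).
Proof. by apply/existsP; exists i; rewrite eqxx. Qed.

Lemma walk_sum_cat psi r p q :
  walk_sum psi r (p ++ q) = walk_sum psi r p + walk_sum psi (last r p) q.
Proof.
by elim: p r => [|s p IHp] r /=; rewrite ?add0r // IHp addrA.
Qed.

Lemma walk_add r i (n : int) :
  exists p, path adjacent r p && (last r p == r + unitv i *~ n).
Proof.
have up m r' : exists p, path adjacent r' p && (last r' p == r' + unitv i *+ m).
  elim: m r' => [|m IHm] r'; first by exists [::]; rewrite /= addr0.
  have [p /andP[pp lp]] := IHm (r' + unitv i).
  exists ((r' + unitv i) :: p).
  by rewrite /= adjacentD pp (eqP lp) mulrS addrA /=.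
case: n => m; first by have [p pP] := up m r; exists p.
have -> : unitv i *~ Negz m = - (unitv i *+ m.+1) by [].
elim: m.+1 => {m} [|m [p /andP[pp /eqP lp]]].
  by exists [::]; rewrite /= oppr0 addr0.
exists (rcons p (r - unitv i *+ m.+1)).
rewrite rcons_path pp last_rcons eqxx lp andbT /=.
by rewrite adjacentC mulrSr opprD addrA -{2}(subrK (unitv i) (r - _)) adjacentD.
Qed.

Lemma lattice_connected r s : exists p, path adjacent r p && (last r p == s).
Proof.
have unitvE (u : lattice I) : u = \sum_i unitv i *~ u i.
  apply/ffunP => j; rewrite sum_ffunE (bigD1 j) //= big1 => [|i ij].
    have -> : (unitv j *~ u j) j = (unitv j j) *~ u j.
      by case: (u j) => n; rewrite ?ffunE ?ffunMnE //= ?ffunE.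
    by rewrite ffunE eqxx addr0 intz.
  have -> : (unitv i *~ u i) j = (unitv i j) *~ u i.
    by case: (u i) => n; rewrite ?ffunE ?ffunMnE //= ?ffunE.
  by rewrite ffunE eq_sym (negPf ij) mul0rz.
suff wP e : exists p, path adjacent r p &&
    (last r p == r + \sum_(i <- e) unitv i *~ (s - r) i).
  by have [p] := wP (index_enum I); rewrite -unitvE addrC subrK; exists p.
elim: e => [|i e [p /andP[pp lp]]].
  by exists [::]; rewrite /= big_nil addr0.
have [q /andP[qq lq]] := walk_add (last r p) i ((s - r) i).
exists (p ++ q); rewrite cat_path pp qq last_cat (eqP lq) (eqP lp).
by rewrite big_cons -addrA [X in r + X]addrC eqxx.
Qed.

(* The value of psi on some path from 0 to r; see potential_eq. *)
Definition potential (psi : lattice I -> lattice I -> G) r : G :=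
  walk_sum psi 0 (xchoose (lattice_connected 0 r)).

Lemma potential_eq psi r p : is_cocycle psi ->
  path adjacent 0 p -> last 0 p = r -> potential psi r = walk_sum psi 0 p.
Proof.
move=> cpsi pp lp; rewrite /potential.
have /andP[pq /eqP lq] := xchooseP (lattice_connected 0 r).
set q := xchoose _ in pq lq *.
have [t /andP[pt /eqP lt]] := lattice_connected r 0.
have eq0 u : path adjacent 0 u -> last 0 u = r ->
    walk_sum psi 0 u + walk_sum psi r t = 0.
  move=> pu lu; rewrite -lu -walk_sum_cat; apply: cpsi.
    by rewrite cat_path pu lu pt.
  by rewrite last_cat lu lt.
by apply: (addIr (walk_sum psi r t)); rewrite !eq0.
Qed.

Lemma potentialD psi r s : is_cocycle psi -> adjacent r s ->
  potential psi s = potential psi r + psi r s.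
Proof.
move=> cpsi rs; have [p /andP[pp /eqP lp]] := lattice_connected 0 r.
rewrite (potential_eq cpsi pp lp) (@potential_eq _ s (rcons p s)) //.
- by rewrite -cats1 walk_sum_cat /= lp addr0.
- by rewrite rcons_path pp lp.
- by rewrite last_rcons.
Qed.

Lemma cocycle_potential psi (phi : lattice I -> G) :
  (forall r s, adjacent r s -> psi r s = phi s - phi r) -> is_cocycle psi.
Proof.
move=> psiE r p; have wE : path adjacent r p ->
    walk_sum psi r p = phi (last r p) - phi r.
  elim: p r => [|s p IHp] r /=; first by rewrite subrr.
  by case/andP=> rs sp; rewrite psiE // IHp // addrC subrKA.
by move=> /wE -> ->; rewrite subrr.
Qed.
End Lattice.

Section Polycomplexes.
Variables (G : zmodType) (k : comPzRingType) (mu : sym_bichar G k).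
Variable C : gmcat mu.

(* Since zero lies in every homogeneous part, pc_deg also says that every
   pc_d i r is homogeneous. *)
Record polycomplex (d : Order.disp_t) (I : finOrderType d) := Polycomplex {
  pc_ob : lattice I -> C;
  pc_d : forall i r, hom (pc_ob r) (pc_ob (r + unitv i));
  pc_psi : lattice I -> lattice I -> G;
  pc_dd : forall i r, pc_d i (r + unitv i) \oc pc_d i r = 0;
  pc_anti : forall i j r, i != j ->
    pc_d j (r + unitv i) \oc pc_d i r
      = - hom_cast erefl (congr1 pc_ob (addrAC r (unitv j) (unitv i)))
            (pc_d i (r + unitv j) \oc pc_d j r);
  pc_cocycle : is_cocycle pc_psi;
  pc_deg : forall i r, pc_d i r != 0 ->
    homdeg (pc_psi r (r + unitv i)) (pc_d i r)
}.

Lemma castE x y (e : x = x) (e' : y = y) (f : hom x y) :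
  hom_cast (H := @hom _ _ _ C) e e' f = f.
Proof. by rewrite (Prop_irrelevance e erefl) (Prop_irrelevance e' erefl). Qed.

Lemma cast0 x x' y y' (e : x = x') (e' : y = y') :
  hom_cast (H := @hom _ _ _ C) e e' 0 = 0.
Proof. by case: x' / e; case: y' / e'. Qed.

Lemma cast_comp x y z z' (e : z = z') (f : hom y z) (g : hom x y) :
  hom_cast (H := @hom _ _ _ C) erefl e f \oc g
    = hom_cast (H := @hom _ _ _ C) erefl e (f \oc g).
Proof. by case: z' / e. Qed.

Lemma castN x x' y y' (e : x = x') (e' : y = y') (f : hom x y) :
  hom_cast (H := @hom _ _ _ C) e e' (- f)
    = - hom_cast (H := @hom _ _ _ C) e e' f.
Proof. by case: x' / e; case: y' / e'. Qed.

Lemma castZ x x' y y' (e : x = x') (e' : y = y') a (f : hom x y) :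
  hom_cast (H := @hom _ _ _ C) e e' (a *: f)
    = a *: hom_cast (H := @hom _ _ _ C) e e' f.
Proof. by case: x' / e; case: y' / e'. Qed.

Lemma cast_cast x y y' y'' (e : y = y') (e' : y' = y'') (f : hom x y) :
  hom_cast (H := @hom _ _ _ C) erefl e' (hom_cast erefl e f)
    = hom_cast (H := @hom _ _ _ C) erefl (etrans e e') f.
Proof. by case: y'' / e'; case: y' / e. Qed.

Lemma tens_castl x x' x'' y y' (e : x' = x'') (f : hom x x') (g : hom y y') :
  hom_cast (H := @hom _ _ _ C) erefl e f \om g
    = hom_cast (H := @hom _ _ _ C) erefl (congr1 (@gm_tens _ _ _ C ^~ y') e)
        (f \om g).
Proof. by case: x'' / e. Qed.

Lemma tens_castr x x' y y' y'' (e : y' = y'') (f : hom x x') (g : hom y y') :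
  f \om hom_cast (H := @hom _ _ _ C) erefl e g
    = hom_cast (H := @hom _ _ _ C) erefl (congr1 (gm_tens x') e) (f \om g).
Proof. by case: y'' / e. Qed.

Lemma cast_homdeg x x' y y' (e : x = x') (e' : y = y') g (f : hom x y) :
  homdeg g f -> homdeg g (hom_cast (H := @hom _ _ _ C) e e' f).
Proof. by case: x' / e; case: y' / e'. Qed.

Section Total.
Variables (d : Order.disp_t) (I : finOrderType d) (A : polycomplex I).

Lemma pc_homdeg i r : homdeg (pc_psi A r (r + unitv i)) (pc_d A i r).
Proof.
by have [->|/pc_deg//] := eqVneq (pc_d A i r) 0; apply: homdeg0.
Qed.

(* Tot(A)_t is the sum of the A^r with weight r = t. *)
Definition tot_gsum : gsum C := GSum (@weight I) (pc_ob A).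

Definition tot_d : gmx tot_gsum tot_gsum := fun r s =>
  \sum_i (if r + unitv i =P s is ReflectT e
          then hom_cast erefl (congr1 (pc_ob A) e) (pc_d A i r) else 0).

Lemma tot_dE r i : tot_d r (r + unitv i) = pc_d A i r.
Proof.
rewrite /tot_d (bigD1 i) //= big1 ?addr0 => [|j ji].
  by case: eqP => // e; apply: castE.
by case: eqP => // e; case/eqP: ji; apply/unitv_inj/(addrI _ e).
Qed.

Lemma tot_d_neq0 r s : tot_d r s != 0 -> exists i, s = r + unitv i.
Proof.
move=> nz; apply: contrapT => /forallNP ns; move: nz.
rewrite /tot_d big1 ?eqxx // => i _; case: eqP => // e.
by case: (ns i).
Qed.

Lemma tot_d_gmor : is_gmor 1 tot_d.
Proof.
split=> [r|r s /tot_d_neq0[i ->]]; last by rewrite /= weightD weight_unitv.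
apply: (sub_finite_set (B := [set` [seq r + unitv i | i <- enum I]])) => [s /=|].
  by move=> /tot_d_neq0[i ->]; apply: map_f; rewrite mem_enum.
exact: finite_seq.
Qed.

Lemma gmx_comp_tot (X : gsum C) (f : gmx tot_gsum X) r x :
  gmx_comp f tot_d r x = \sum_i f (r + unitv i) x \oc pc_d A i r.
Proof.
rewrite /gmx_comp (fsbigE [seq r + unitv i | i <- index_enum I]) //.
- rewrite big_map.
  by apply: eq_big => [i|i _]; rewrite ?in_setT // tot_dE.
- rewrite map_inj_uniq ?index_enum_uniq // => i j /addrI; exact: unitv_inj.
- move=> s _ sn; have [->|/tot_d_neq0[i si]] := eqVneq (tot_d r s) 0.
    exact: comp0r.
  by case/negP: sn; rewrite si; apply: map_f; rewrite mem_index_enum.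
Qed.

Lemma tot_dd r t : gmx_comp tot_d tot_d r t = 0.
Proof.
rewrite gmx_comp_tot.
pose F i j := (if r + unitv i + unitv j =P t is ReflectT e
  then hom_cast erefl (congr1 (pc_ob A) e) (pc_d A j (r + unitv i)) else 0)
  \oc pc_d A i r.
have FC i j : i != j -> F i j = - F j i.
  move=> ij; rewrite /F {F}; case: eqP => [e|ne]; case: eqP => [e'|ne'].
  - case: t / e e' => e'; rewrite castE pc_anti // cast_comp.
    by rewrite (Prop_irrelevance (addrAC _ _ _) e').
  - by case: ne'; rewrite -e addrAC.
  - by case: ne; rewrite -e' addrAC.
  - by rewrite !comp0l oppr0.
have F0 i : F i i = 0.
  rewrite /F {F FC}; case: eqP => [e|_]; last exact: comp0l.
  by case: t / e; rewrite castE pc_dd.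
transitivity (\sum_i \sum_j F i j).
  by apply: eq_bigr => i _; rewrite comp_suml.
transitivity (\sum_i (\sum_(j | (j < i)%O) F i j + \sum_(j | (i < j)%O) F i j)).
  apply: eq_bigr => i _; rewrite (bigD1 i) //= F0 add0r.
  rewrite (bigID (fun j => (j < i)%O)) /=; congr (_ + _); apply: eq_bigl => j.
    by case: ltgtP.
  by case: ltgtP.
rewrite big_split /= (exchange_big_dep xpredT) //= -big_split big1 //= => i _.
by rewrite -big_split big1 //= => j ij; rewrite FC ?addNr // gt_eqF.
Qed.

Definition Tot : complex C := Complex tot_d_gmor tot_dd.

End Total.

Section Tensor.
Variables (d d' : Order.disp_t) (I : finOrderType d) (J : finOrderType d').
Variables (A : polycomplex I) (B : polycomplex J).
Local Notation K := (ordsum I J).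
Implicit Types r : lattice K.

Definition inlo (i : I) : K := inl i.
Definition inro (j : J) : K := inr j.

Definition resl r : lattice I := [ffun i => r (inlo i)].
Definition resr r : lattice J := [ffun j => r (inro j)].

Lemma reslDl r i : resl r + unitv i = resl (r + unitv (inlo i)).
Proof. by apply/ffunP => i'; rewrite !ffunE. Qed.
Lemma resrDl r i : resr r = resr (r + unitv (inlo i)).
Proof. by apply/ffunP => i'; rewrite !ffunE addr0. Qed.
Lemma reslDr r j : resl r = resl (r + unitv (inro j)).
Proof. by apply/ffunP => i'; rewrite !ffunE addr0. Qed.
Lemma resrDr r j : resr r + unitv j = resr (r + unitv (inro j)).
Proof. by apply/ffunP => i'; rewrite !ffunE. Qed.

Definition tens_ob r : C := pc_ob A (resl r) \ot pc_ob B (resr r).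

Lemma tens_obl r i : pc_ob A (resl r + unitv i) \ot pc_ob B (resr r)
  = tens_ob (r + unitv (inlo i)).
Proof. by rewrite /tens_ob reslDl -resrDl. Qed.

Lemma tens_obr r j : pc_ob A (resl r) \ot pc_ob B (resr r + unitv j)
  = tens_ob (r + unitv (inro j)).
Proof. by rewrite /tens_ob resrDr -reslDr. Qed.

(* (-1)^n for n : int; n and |n| have the same parity. *)
Definition intsign (n : int) : k := (-1) ^+ absz n.

Definition tens_coef r j : k :=
  intsign (weight (resl r)) *
  mu (potential (pc_psi A) (resl r))
     (pc_psi B (resr r) (resr r + unitv j)).

(* The casts identify resl (r + unitv (inl i)) with resl r + unitv i and
   resr (r + unitv (inl i)) with resr r, and similarly for inr j. *)
Definition tens_d (c : K) r : hom (tens_ob r) (tens_ob (r + unitv c)) :=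
  match c with
  | inl i => hom_cast erefl (tens_obl r i)
               (pc_d A i (resl r) \om gm_id (pc_ob B (resr r)))
  | inr j => tens_coef r j *: hom_cast erefl (tens_obr r j)
               (gm_id (pc_ob A (resl r)) \om pc_d B j (resr r))
  end.

(* On an edge of the lattice of I + J exactly one of the two restrictions of
   the endpoints changes. *)
Definition tens_psi (r s : lattice K) : G :=
  if resr r == resr s then pc_psi A (resl r) (resl s)
  else pc_psi B (resr r) (resr s).

Lemma unitv_neq0 (L : finType) (i : L) (r : lattice L) : (r == r + unitv i) = false.
Proof.
apply/eqP => /esym/eqP; rewrite -[X in _ == X]addr0 => /eqP/addrI.
by move/(congr1 (@weight L)); rewrite weight_unitv /weight big1 // => j; rewrite ffunE.
Qed.

Lemma tens_psil r i : tens_psi r (r + unitv (inlo i))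
  = pc_psi A (resl r) (resl r + unitv i).
Proof. by rewrite /tens_psi -resrDl eqxx reslDl. Qed.

Lemma tens_psir r j : tens_psi r (r + unitv (inro j))
  = pc_psi B (resr r) (resr r + unitv j).
Proof. by rewrite /tens_psi -resrDr unitv_neq0. Qed.

Lemma tens_cocycle : is_cocycle tens_psi.
Proof.
apply: (cocycle_potential (phi := fun r =>
  potential (pc_psi A) (resl r) + potential (pc_psi B) (resr r))) => r s.
have Al (L : finType) (psi : lattice L -> lattice L -> G) u v :
    is_cocycle psi -> adjacent u v -> psi u v = potential psi v - potential psi u.
  by move=> cpsi uv; rewrite (potentialD cpsi uv) addrC addKr.
case/existsP=> -[i|j] /orP[] /eqP ->; rewrite /tens_psi.
- rewrite -!resrDl eqxx -reslDl opprD addrACA subrr addr0.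
  by apply: Al (adjacentD _ _); apply: pc_cocycle.
- rewrite -!resrDl eqxx -reslDl opprD addrACA subrr addr0.
  by apply: Al; [apply: pc_cocycle | rewrite adjacentC adjacentD].
- rewrite -!reslDr -!resrDr unitv_neq0 opprD addrACA subrr add0r.
  by apply: Al (adjacentD _ _); apply: pc_cocycle.
- rewrite -!reslDr -!resrDr eq_sym unitv_neq0 opprD addrACA subrr add0r.
  by apply: Al; [apply: pc_cocycle | rewrite adjacentC adjacentD].
Qed.

Lemma tens_deg c r : tens_d c r != 0 ->
  homdeg (tens_psi r (r + unitv c)) (tens_d c r).
Proof.
move=> _; case: c => [i|j]; rewrite /tens_d.
- rewrite tens_psil; apply: cast_homdeg; rewrite -[X in homdeg X]addr0.
  exact: gm_tens_deg (pc_homdeg _ _ _) (homdeg_id _).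
- rewrite tens_psir; apply/homdegZ/cast_homdeg; rewrite -[X in homdeg X]add0r.
  exact: gm_tens_deg (homdeg_id _) (pc_homdeg _ _ _).
Qed.

Lemma intsignD1 n : intsign (n + 1) = - intsign n.
Proof.
rewrite /intsign; case: n => [n|n]; first by rewrite -PoszD addn1 exprS mulN1r.
have -> : Negz n + 1 = - n%:Z by rewrite NegzE -addn1 PoszD opprD subrK.
by rewrite abszN /= exprS mulN1r opprK.
Qed.

Lemma comp_ll r i i' E :
  tens_d (inlo i') (r + unitv (inlo i)) \oc tens_d (inlo i) r
  = hom_cast erefl E
      ((pc_d A i' (resl r + unitv i) \oc pc_d A i (resl r))
         \om gm_id (pc_ob B (resr r))).
Proof.
rewrite /tens_d /=; move: (tens_obl r i) (tens_obl (r + _) i') E.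
rewrite /tens_ob.
move: (resl (_ + _ + _)) (resr (_ + _ + _)) => u2 v2.
rewrite -reslDl -resrDl => e1 e2 e3.
rewrite castE; move: e2 e3; move: (pc_ob A u2 \ot _) => T e2; case: T / e2 => e3.
rewrite !castE (gm_interchange (pc_homdeg _ _ _) (homdeg_id _)
  (pc_homdeg _ _ _) (homdeg_id _)).
by rewrite bichar0l scale1r gm_comp1l.
Qed.

Lemma comp_lr r i j E :
  tens_d (inro j) (r + unitv (inlo i)) \oc tens_d (inlo i) r
  = (- tens_coef r j) *:
    hom_cast erefl E (pc_d A i (resl r) \om pc_d B j (resr r)).
Proof.
have coefE : tens_coef (r + unitv (inlo i)) j
    * mu (pc_psi B (resr r) (resr r + unitv j))
         (pc_psi A (resl r) (resl r + unitv i)) = - tens_coef r j.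
  rewrite /tens_coef -reslDl -resrDl weightD weight_unitv intsignD1.
  rewrite (potentialD (pc_cocycle A) (adjacentD _ _)) bicharDl.
  by rewrite mulNr mulNr -!mulrA bichar_sym mulr1.
rewrite -coefE /tens_d /=.
move: (tens_coef (_ + _) _) => a.
move: (tens_obl r i) (tens_obr (r + _) j) E.
rewrite /tens_ob.
move: (resl (_ + _ + _)) (resr (_ + _ + _)) => u2 v2.
rewrite -reslDl -resrDl => e1 e2 e3.
rewrite castE; move: e2 e3; move: (pc_ob A u2 \ot _) => T e2; case: T / e2 => e3.
rewrite !castE compZl (gm_interchange (homdeg_id _) (pc_homdeg _ _ _)
  (pc_homdeg _ _ _) (homdeg_id _)).
by rewrite gm_comp1l gm_comp1r scalerA.
Qed.

Lemma comp_rl r i j E :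
  tens_d (inlo i) (r + unitv (inro j)) \oc tens_d (inro j) r
  = tens_coef r j *:
    hom_cast erefl E (pc_d A i (resl r) \om pc_d B j (resr r)).
Proof.
rewrite /tens_d /=.
move: (tens_coef _ _) => a.
move: (tens_obr r j) (tens_obl (r + _) i) E.
rewrite /tens_ob.
move: (resl (_ + _ + _)) (resr (_ + _ + _)) => u2 v2.
rewrite -reslDr -resrDr => e1 e2 e3.
rewrite castE; move: e2 e3; move: (pc_ob A u2 \ot _) => T e2; case: T / e2 => e3.
rewrite !castE compZr (gm_interchange (pc_homdeg _ _ _) (homdeg_id _)
  (homdeg_id _) (pc_homdeg _ _ _)).
by rewrite gm_comp1l gm_comp1r bichar0l scale1r.
Qed.

Lemma comp_rr r j j' E :
  tens_d (inro j') (r + unitv (inro j)) \oc tens_d (inro j) r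
  = mu (potential (pc_psi A) (resl r))
       (potential (pc_psi B) (resr r + unitv j + unitv j')
          - potential (pc_psi B) (resr r)) *:
    hom_cast erefl E (gm_id (pc_ob A (resl r)) \om
      (pc_d B j' (resr r + unitv j) \oc pc_d B j (resr r))).
Proof.
have coefE : tens_coef (r + unitv (inro j)) j' * tens_coef r j
    = mu (potential (pc_psi A) (resl r))
       (potential (pc_psi B) (resr r + unitv j + unitv j')
          - potential (pc_psi B) (resr r)).
  rewrite /tens_coef -reslDr -resrDr mulrACA -bicharDr.
  rewrite !(potentialD (pc_cocycle B) (adjacentD _ _)).
  rewrite /intsign -exprMn mulrNN mulr1 expr1n mul1r.
  have sE (p a b : G) : p + a + b - p = b + a.
    by rewrite [LHS]addrC -addrA addKr addrC.
  by rewrite sE.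
rewrite -coefE /tens_d /=.
move: (tens_coef (_ + _) _) (tens_coef r j) => a b.
move: (tens_obr r j) (tens_obr (r + _) j') E.
rewrite /tens_ob.
move: (resl (_ + _ + _)) (resr (_ + _ + _)) => u2 v2.
rewrite -reslDr -resrDr => e1 e2 e3.
rewrite castE; move: e2 e3; move: (pc_ob A u2 \ot _) => T e2; case: T / e2 => e3.
rewrite !castE compZr compZl (gm_interchange (homdeg_id _) (pc_homdeg _ _ _)
  (homdeg_id _) (pc_homdeg _ _ _)).
by rewrite gm_comp1l bichar0r scale1r scalerA mulrC.
Qed.


Lemma tens_dd c r : tens_d c (r + unitv c) \oc tens_d c r = 0.
Proof.
case: c => [i|j].
- have E : pc_ob A (resl r + unitv i + unitv i) \ot pc_ob B (resr r)
      = tens_ob (r + unitv (inlo i) + unitv (inlo i)).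
    by rewrite /tens_ob -!reslDl -!resrDl.
  by rewrite (comp_ll E) pc_dd tens0l cast0.
- have E : pc_ob A (resl r) \ot pc_ob B (resr r + unitv j + unitv j)
      = tens_ob (r + unitv (inro j) + unitv (inro j)).
    by rewrite /tens_ob -!reslDr -!resrDr.
  by rewrite (comp_rr E) pc_dd tens0r cast0 scaler0.
Qed.

Lemma tens_anti c c' r : c != c' ->
  tens_d c' (r + unitv c) \oc tens_d c r
    = - hom_cast erefl (congr1 tens_ob (addrAC r (unitv c') (unitv c)))
          (tens_d c (r + unitv c') \oc tens_d c' r).
Proof.
case: c c' => [i|j] [i'|j'] ne.
- have E : pc_ob A (resl r + unitv i + unitv i') \ot pc_ob B (resr r)
      = tens_ob (r + unitv (inlo i) + unitv (inlo i')).
    by rewrite /tens_ob -!reslDl -!resrDl.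
  have E' : pc_ob A (resl r + unitv i' + unitv i) \ot pc_ob B (resr r)
      = tens_ob (r + unitv (inlo i') + unitv (inlo i)).
    by rewrite /tens_ob -!reslDl -!resrDl.
  rewrite (comp_ll E) (comp_ll E') pc_anti //.
  by rewrite tensNl castN tens_castl !cast_cast; congr (- hom_cast _ _ _);
    exact: Prop_irrelevance.
- have E : pc_ob A (resl r + unitv i) \ot pc_ob B (resr r + unitv j')
      = tens_ob (r + unitv (inlo i) + unitv (inro j')).
    by rewrite /tens_ob -!reslDr -!reslDl -!resrDr -!resrDl.
  have E' : pc_ob A (resl r + unitv i) \ot pc_ob B (resr r + unitv j')
      = tens_ob (r + unitv (inro j') + unitv (inlo i)).
    by rewrite /tens_ob -!reslDl -!reslDr -!resrDl -!resrDr.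
  rewrite (comp_lr E) (comp_rl E') castZ cast_cast scaleNr.
  congr (- (_ *: hom_cast _ _ _)); exact: Prop_irrelevance.
- have E : pc_ob A (resl r + unitv i') \ot pc_ob B (resr r + unitv j)
      = tens_ob (r + unitv (inlo i') + unitv (inro j)).
    by rewrite /tens_ob -!reslDr -!reslDl -!resrDr -!resrDl.
  have E' : pc_ob A (resl r + unitv i') \ot pc_ob B (resr r + unitv j)
      = tens_ob (r + unitv (inro j) + unitv (inlo i')).
    by rewrite /tens_ob -!reslDl -!reslDr -!resrDl -!resrDr.
  rewrite (comp_lr E) (comp_rl E') castZ cast_cast scaleNr opprK.
  congr (_ *: hom_cast _ _ _); exact: Prop_irrelevance.
- have E : pc_ob A (resl r) \ot pc_ob B (resr r + unitv j + unitv j')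
      = tens_ob (r + unitv (inro j) + unitv (inro j')).
    by rewrite /tens_ob -!reslDr -!resrDr.
  have E' : pc_ob A (resl r) \ot pc_ob B (resr r + unitv j' + unitv j)
      = tens_ob (r + unitv (inro j') + unitv (inro j)).
    by rewrite /tens_ob -!reslDr -!resrDr.
  pose w l l' := mu (potential (pc_psi A) (resl r))
    (potential (pc_psi B) (resr r + unitv l + unitv l')
       - potential (pc_psi B) (resr r)).
  have wC : w j j' = w j' j by rewrite /w addrAC.
  rewrite (comp_rr E) (comp_rr E') pc_anti //.
  rewrite tensNr castN tens_castr castZ !cast_cast scalerN.
  rewrite -/(w j j') -/(w j' j) wC; congr (- (_ *: hom_cast _ _ _)).
  exact: Prop_irrelevance.
Qed.

Definition pc_tens : polycomplex K :=
  Polycomplex tens_dd tens_anti tens_cocycle tens_deg.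

End Tensor.

(* A and B may have different index sets. *)
Definition pc_hequiv (d d' : Order.disp_t) (I : finOrderType d)
    (J : finOrderType d') (A : polycomplex I) (B : polycomplex J) :=
  homotopy_equivalent (Tot A) (Tot B).

End Polycomplexes.

Arguments polycomplex {G k mu} C {d} I.
Notation "A ⊗ B" := (pc_tens A B)
  (at level 40, left associativity) : gmcat_scope.
Notation "A ≃ B" := (pc_hequiv A B) (at level 70) : gmcat_scope.

(* Main.v *)
From mathcomp Require Import all_boot all_order all_algebra all_classical.
Require Import Defs.

(** Both factors are replaced one at a time, homotopy equivalence being
    transitive.  A matrix between total complexes has components of arbitrary
    degree, so the scalar [mu u deg] of the Koszul rule is applied to each
    homogeneous part separately, by the operator [twist u].  Regard the object
    in position [r] as shifted by the value of the cocycle at [r]: all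
    differentials then have shifted degree 0.  With the signs and scalars of
    [tensmx] the tensor product of matrices satisfies
    (f (x) g) (h (x) l) = +- (f h) (x) (g l) as soon as [h] or [g] has shifted
    degree 0, and the differential of a tensor product of polycomplexes is
    d (x) 1 + 1 (x) d.  Hence f |-> f (x) 1 and g |-> 1 (x) g preserve chain
    maps, homotopies, composition and identities. *)

Set Implicit Arguments.
Unset Strict Implicit.
Unset Printing Implicit Defensive.
Import GRing.Theory.
Local Open Scope classical_set_scope.
Local Open Scope ring_scope.
Local Open Scope gmcat_scope.

(** * Multiplying homogeneous parts by [mu u], and interchange laws with inhomogeneous factors *)

Section Twist.
Variables (G : zmodType) (k : comPzRingType) (mu : sym_bichar G k).
Variable C : gmcat mu.
Implicit Types (u v g : G).

Lemma tens_suml (x x' y y' : C) T (s : seq T) (F : T -> hom x x')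
    (g : hom y y') :
  (\sum_(i <- s) F i) \om g = \sum_(i <- s) F i \om g.
Proof.
exact: (big_morph (fun f => f \om g) (fun f f' => tensDl f f' g)
  (tens0l _ _ g)).
Qed.

Lemma tens_sumr (x x' y y' : C) T (s : seq T) (F : T -> hom y y')
    (f : hom x x') :
  f \om (\sum_(i <- s) F i) = \sum_(i <- s) f \om F i.
Proof. exact: (big_morph (gm_tensm f) (tensDr f) (tens0r _ _ f)). Qed.

Lemma tensZl (x x' y y' : C) (a : k) (f : hom x x') (g : hom y y') :
  (a *: f) \om g = a *: (f \om g).
Proof. by rewrite -[a *: f]addr0 gm_tensPl tens0l addr0. Qed.

Lemma tensZr (x x' y y' : C) (a : k) (f : hom x x') (g : hom y y') :
  f \om (a *: g) = a *: (f \om g).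
Proof. by rewrite -[a *: g]addr0 gm_tensPr tens0r addr0. Qed.

(** Degrees may repeat, so that decompositions of two morphisms concatenate to a decomposition of
    their sum. *)
Definition homogeneous_seq (x y : C) (L : seq (G * hom x y)) :=
  forall e, e \in L -> homdeg e.1 e.2.

Lemma homogeneous_seq_ex (x y : C) (f : hom x y) :
  exists L, homogeneous_seq L /\ f = \sum_(e <- L) e.2.
Proof.
have [s [c [_ Dc ->]]] := grading_span (hom_grading x y) f.
exists [seq (g, c g) | g <- s]; split; last by rewrite big_map.
by move=> _ /mapP[g _ ->]; apply: Dc.
Qed.

Lemma homdeg_sum (x y : C) g T (s : seq T) (P : pred T) (F : T -> hom x y) :
  (forall i, P i -> homdeg g (F i)) -> homdeg g (\sum_(i <- s | P i) F i).
Proof.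
move=> FP; elim/big_ind: _ => //; first exact: homdeg0.
move=> f f' fg f'g; rewrite -[f]scale1r.
exact: (gradingP (hom_grading x y)).
Qed.

(** Grouped by degree, the terms of each degree sum to 0 because the grading is direct, and a scalar
    depending on the degree alone is constant on each group. This makes [twist] independent of the
    decomposition. *)
Lemma homogeneous_sum0 (x y : C) (L : seq (G * hom x y)) (a : G -> k) :
  homogeneous_seq L -> \sum_(e <- L) e.2 = 0 -> \sum_(e <- L) a e.1 *: e.2 = 0.
Proof.
move=> LP L0; pose s := undup [seq e.1 | e <- L].
have sumE (F : G * hom x y -> hom x y) :
    \sum_(e <- L) F e = \sum_(g <- s) \sum_(e <- L | e.1 == g) F e.
  rewrite (exchange_big_dep xpredT) //= [LHS]big_seq [RHS]big_seq.
  apply: eq_bigr => e eL; rewrite -big_filter.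
  rewrite (eq_filter (a2 := pred1 e.1)); last by move=> g; rewrite /= eq_sym.
  by rewrite filter_pred1_uniq ?undup_uniq ?big_seq1 ?mem_undup ?map_f.
rewrite sumE big_seq big1 // => g gs.
rewrite (eq_bigr (fun e => a g *: e.2)) => [|e /eqP -> //].
rewrite -scaler_sumr.
rewrite sumE in L0; rewrite -big_filter.
have -> : \sum_(e <- [seq e <- L | e.1 == g]) e.2 = 0; last exact: scaler0.
rewrite big_filter.
(* Membership in [L] is added to the filter because homogeneity is known only for the members of
   [L]. *)
pose c h : hom x y := \sum_(e <- L | (e.1 == h) && (e \in L)) e.2.
have cE h : \sum_(e <- L | e.1 == h) e.2 = c h.
  by rewrite /c big_seq_cond; apply: eq_bigl => e; rewrite andbC.
rewrite cE; apply: (grading_free (hom_grading x y) (undup_uniq _) _ _ gs).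
  by move=> h; apply: homdeg_sum => e /andP[/eqP <- /LP].
by rewrite -[RHS]L0; apply: eq_bigr => h _; rewrite cE.
Qed.

(* [twist u] multiplies the part of degree [g] of a morphism by [mu u g]; it
   does not depend on the chosen decomposition, see [twistE]. *)
Definition twist (x y : C) u (f : hom x y) : hom x y :=
  \sum_(e <- sval (cid (homogeneous_seq_ex f))) mu u e.1 *: e.2.

Lemma twistE (x y : C) u (L : seq (G * hom x y)) : homogeneous_seq L ->
  twist u (\sum_(e <- L) e.2) = \sum_(e <- L) mu u e.1 *: e.2.
Proof.
move=> LP; rewrite /twist; case: cid => M [MP E] /=; apply/eqP.
rewrite -subr_eq0; apply/eqP.
(* The chosen decomposition [M] followed by the negatives of [L] sums to 0. *)
have := @homogeneous_sum0 _ _ (M ++ [seq (e.1, - e.2) | e <- L]) (mu u).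
rewrite !big_cat !big_map /= sumrN -E subrr.
rewrite (eq_bigr (fun e => - (mu u e.1 *: e.2)) (r := L)); last first.
  by move=> e _; rewrite scalerN.
rewrite sumrN => -> // e.
rewrite mem_cat => /orP[/MP //|/mapP[e' /LP e'L ->]] /=.
by rewrite -scaleN1r; apply: homdegZ.
Qed.

Lemma twist_homdeg (x y : C) u g (f : hom x y) :
  homdeg g f -> twist u f = mu u g *: f.
Proof.
move=> fg; have := @twistE _ _ u [:: (g, f)]; rewrite !big_seq1 /=; apply.
by move=> e; rewrite inE => /eqP ->.
Qed.

Lemma twistD (x y : C) u (f f' : hom x y) :
  twist u (f + f') = twist u f + twist u f'.
Proof.
have [L [LP ->]] := homogeneous_seq_ex f.
have [M [MP ->]] := homogeneous_seq_ex f'.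
rewrite -big_cat !twistE ?big_cat // => e; rewrite mem_cat.
by move=> /orP[/LP|/MP].
Qed.

(** Identities additive in a morphism need checking on homogeneous ones only; the empty sum is
    covered since 0 is homogeneous. *)
Lemma hom_ind (x y : C) (P : hom x y -> Prop) :
  (forall f f', P f -> P f' -> P (f + f')) ->
  (forall g f, homdeg g f -> P f) -> forall f, P f.
Proof.
move=> PD Ph f; have [L [LP ->]] := homogeneous_seq_ex f.
rewrite big_seq; apply: big_ind => // [|e /LP /Ph //].
exact: (Ph 0) (homdeg0 _ _ _).
Qed.

Lemma twist0 (x y : C) u : twist u (0 : hom x y) = 0.
Proof. by rewrite (twist_homdeg u (homdeg0 x y 0)) scaler0. Qed.

Lemma twist_sum (x y : C) u T (s : seq T) (F : T -> hom x y) :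
  twist u (\sum_(i <- s) F i) = \sum_(i <- s) twist u (F i).
Proof. exact: (big_morph _ (@twistD x y u) (twist0 x y u)). Qed.

(** Degrees add under composition and [mu u] turns sums into products. *)
Lemma twist_comp (x y z : C) u (f : hom y z) (g : hom x y) :
  twist u (f \oc g) = twist u f \oc twist u g.
Proof.
elim/hom_ind: f => [f f' IH IH'|a f fa].
  by rewrite compDl !twistD IH IH' compDl.
elim/hom_ind: g => [g g' IH IH'|b g gb].
  by rewrite compDr !twistD IH IH' compDr.
rewrite (twist_homdeg u fa) (twist_homdeg u gb).
by rewrite (twist_homdeg u (gm_comp_deg fa gb)) compZl compZr scalerA bicharDr.
Qed.

Lemma twistZ (x y : C) u (a : k) (f : hom x y) :
  twist u (a *: f) = a *: twist u f.
Proof.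
elim/hom_ind: f => [f f' IH IH'|b f fb].
  by rewrite scalerDr !twistD IH IH' scalerDr.
by rewrite (twist_homdeg _ (homdegZ _ fb)) (twist_homdeg _ fb) !scalerA mulrC.
Qed.

Lemma twistDu (x y : C) u v (f : hom x y) :
  twist (u + v) f = twist u (twist v f).
Proof.
elim/hom_ind: f => [f f' IH IH'|a f fa]; first by rewrite !twistD IH IH'.
rewrite !(twist_homdeg _ fa) (twist_homdeg _ (homdegZ _ fa)) scalerA.
by rewrite bicharDl.
Qed.

Lemma twist_id (x : C) u : twist u (gm_id x) = gm_id x.
Proof. by rewrite (twist_homdeg u (homdeg_id x)) bichar0r scale1r. Qed.

(** The Koszul scalar sees only the degrees of [g] and [h]; with that of [g] fixed to [b], it acts
    on [h] as [twist b]. *)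
Lemma interchange_homdegr (x x' x'' y y' y'' : C) b
    (f : hom x' x'') (g : hom y' y'') (h : hom x x') (l : hom y y') :
  homdeg b g ->
  (f \om g) \oc (h \om l) = (f \oc twist b h) \om (g \oc l).
Proof.
move=> gb; elim/hom_ind: f => [f f' IH IH'|a f fa].
  by rewrite tensDl !compDl IH IH' tensDl.
elim/hom_ind: h => [h h' IH IH'|c h hc].
  by rewrite tensDl compDr IH IH' twistD compDr tensDl.
elim/hom_ind: l => [l l' IH IH'|d l ld].
  by rewrite tensDr !compDr IH IH' tensDr.
by rewrite (gm_interchange fa gb hc ld) (twist_homdeg _ hc) compZr tensZl.
Qed.

(** Both sides are the inverse of [mu u g], one by bilinearity and the other by symmetry. *)
Lemma bicharN u g : mu (- u) g = mu g u.
Proof.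
rewrite -[LHS]mulr1 -(bichar_sym mu u g) mulrA -bicharDl addNr.
by rewrite bichar0l mul1r.
Qed.

(** Now the degree of [h] is fixed. The scalar [mu b c] has the degree of [g] on the left, so by
    symmetry it is the twist of [g] by [- c]. *)
Lemma interchange_homdegl (x x' x'' y y' y'' : C) c
    (f : hom x' x'') (g : hom y' y'') (h : hom x x') (l : hom y y') :
  homdeg c h ->
  (f \om g) \oc (h \om l) = (f \oc h) \om (twist (- c) g \oc l).
Proof.
move=> hc; elim/hom_ind: f => [f f' IH IH'|a f fa].
  by rewrite tensDl !compDl IH IH' tensDl.
elim/hom_ind: g => [g g' IH IH'|b g gb].
  by rewrite tensDr compDl IH IH' twistD compDl tensDr.
elim/hom_ind: l => [l l' IH IH'|d l ld].
  by rewrite tensDr !compDr IH IH' tensDr.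
rewrite (gm_interchange fa gb hc ld) (twist_homdeg _ gb) compZl tensZr.
by rewrite bicharN.
Qed.

End Twist.

(** * Algebra of matrices with finite columns *)

Section Matrices.
Variables (G : zmodType) (k : comPzRingType) (mu : sym_bichar G k).
Variable C : gmcat mu.
Implicit Types X Y Z W : gsum C.

(** Finiteness is given by a duplicate-free list, over which composites become ordinary finite
    sums. *)
Definition column_finite X Y (f : gmx X Y) :=
  forall x, exists2 s : seq (gs_ix Y), uniq s & forall y, f x y != 0 -> y \in s.

Lemma gmor_fin X Y n (f : gmx X Y) : is_gmor n f -> column_finite f.
Proof.
move=> [ff _] x; have /finite_seqP[s sE] := ff x.
exists (undup s); first exact: undup_uniq.
by move=> y fy; rewrite mem_undup; have : [set` s] y by rewrite -sE.
Qed.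

Lemma gmorP X Y n (f : gmx X Y) : column_finite f ->
  (forall x y, f x y != 0 -> gs_wt y = gs_wt x + n) -> is_gmor n f.
Proof.
move=> ff fn; split=> // x; have [s _ sP] := ff x.
by apply: sub_finite_set (finite_seq s) => y /sP.
Qed.

(** Any list containing the support of the column will do, so several composites can be expanded
    over a common list. *)
Lemma gmx_compE X Y Z (f : gmx Y Z) (g : gmx X Y) x z (s : seq (gs_ix Y)) :
  uniq s -> (forall y, g x y != 0 -> y \in s) ->
  gmx_comp f g x z = \sum_(y <- s) f y z \oc g x y.
Proof.
move=> us gs; rewrite /gmx_comp (fsbigE s) //.
  by apply: eq_bigl => y; rewrite in_setT.
move=> y _ ys; have [->|/gs] := eqVneq (g x y) 0; first exact: comp0r.
by rewrite (negPf ys).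
Qed.

Lemma gmxP X Y (f g : gmx X Y) : (forall x y, f x y = g x y) -> f = g.
Proof.
move=> fg; apply: functional_extensionality_dep => x.
exact: functional_extensionality_dep.
Qed.

Lemma gmx_comp_neq0 X Y Z (f : gmx Y Z) (g : gmx X Y) x z :
  column_finite g -> gmx_comp f g x z != 0 ->
  exists2 y, g x y != 0 & f y z != 0.
Proof.
move=> gf; have [s us sP] := gf x; rewrite (gmx_compE _ _ us sP) => nz.
apply: contrapT => H; case/eqP: nz; apply: big1 => y _.
have [->|gy] := eqVneq (g x y) 0; first exact: comp0r.
have [->|fy] := eqVneq (f y z) 0; first exact: comp0l.
by case: H; exists y.
Qed.

Lemma gmor_comp X Y Z m n (f : gmx Y Z) (g : gmx X Y) :
  is_gmor m f -> is_gmor n g -> is_gmor (n + m) (gmx_comp f g).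
Proof.
move=> fm gn; have ff := gmor_fin fm.
have gf := gmor_fin gn; apply: gmorP => [x|x z].
  have [s _ sP] := gf x.
  have tP y : {t : seq _ | forall z, f y z != 0 -> z \in t}.
    by apply: cid; have [t _ tP] := ff y; exists t.
  (* The column of the composite is supported in the union of the columns of [f] at the support [s]
     of the column of [g]. *)
  exists (undup (flatten [seq sval (tP y) | y <- s])).
    exact: undup_uniq.
  move=> z /(gmx_comp_neq0 gf)[y /sP ys fyz]; rewrite mem_undup.
  apply/flatten_mapP; exists y => //.
  exact: (svalP (tP y)).
by move=> /(gmx_comp_neq0 gf)[y /gn.2 yE /fm.2 ->]; rewrite yE addrA.
Qed.

Lemma gmx_compA X Y Z W (f : gmx Z W) (g : gmx Y Z) (h : gmx X Y) :
  column_finite g -> column_finite h ->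
  gmx_comp f (gmx_comp g h) = gmx_comp (gmx_comp f g) h.
Proof.
move=> gf hf; apply: gmxP => x w.
have [s us sP] := hf x.
have tP y : {t : seq _ | forall z, g y z != 0 -> z \in t}.
  by apply: cid; have [t _ tP] := gf y; exists t.
(* With [t] containing all columns of [g] at points of [s], both sides are double sums over [s] and
   [t], in opposite orders. *)
pose t := undup (flatten [seq sval (tP y) | y <- s]).
have tPs y : y \in s -> forall z, g y z != 0 -> z \in t.
  move=> ys z /(svalP (tP y)) zt; rewrite mem_undup.
  by apply/flatten_mapP; exists y.
rewrite (gmx_compE _ _ us sP) (@gmx_compE _ _ _ _ _ _ _ t) ?undup_uniq //.
  rewrite [RHS]big_seq (eq_bigr (fun y =>
    \sum_(z <- t) f z w \oc g y z \oc h x y)).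
    rewrite -big_seq exchange_big; apply: eq_bigr => z _.
    rewrite (gmx_compE _ _ us sP) comp_sumr; apply: eq_bigr => y _.
    exact: gm_compA.
  move=> y ys; rewrite (@gmx_compE _ _ _ _ _ _ _ t) ?undup_uniq ?comp_suml //.
  exact: tPs.
move=> z /(gmx_comp_neq0 hf)[y hy]; apply: tPs; exact: sP.
Qed.

Lemma gmx_id_gmor X : is_gmor 0 (@gmx_id _ _ _ _ X).
Proof.
apply: gmorP => [x|x y]; rewrite /gmx_id; last first.
  by case: eqP => [e _|_]; rewrite ?eqxx // addr0 e.
by exists [:: x] => // y; case: eqP => [e _|_]; rewrite ?eqxx // e mem_head.
Qed.

Lemma gmx_idxx X x : gmx_id (X := X) x x = gm_id (gs_ob x).
Proof. by rewrite /gmx_id; case: eqP => // e; rewrite castE. Qed.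

Lemma gmx_id_neq X x y : x != y -> gmx_id (X := X) x y = 0.
Proof. by rewrite /gmx_id; case: eqP. Qed.

Lemma gmx_comp1l X Y (f : gmx X Y) : column_finite f ->
  gmx_comp (@gmx_id _ _ _ _ Y) f = f.
Proof.
move=> ff; apply: gmxP => x y; have [s us sP] := ff x.
(* The index [y] is added to the list so that the diagonal term can be extracted even when
   [f x y = 0]. *)
rewrite (@gmx_compE _ _ _ _ _ _ _ (undup (y :: s))) ?undup_uniq //.
  rewrite (bigD1_seq y) ?undup_uniq ?mem_undup ?mem_head //= gmx_idxx gm_comp1l.
  by rewrite big1 ?addr0 // => z /gmx_id_neq ->; rewrite comp0l.
by move=> z /sP zs; rewrite mem_undup inE zs orbT.
Qed.

Lemma gmx_comp1r X Y (f : gmx X Y) : gmx_comp f (@gmx_id _ _ _ _ X) = f.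
Proof.
apply: gmxP => x y; rewrite (@gmx_compE _ _ _ _ _ _ _ [:: x]) //.
  by rewrite big_seq1 gmx_idxx gm_comp1r.
by move=> z; apply: contra_neqT => zx; rewrite gmx_id_neq // eq_sym -mem_seq1.
Qed.

Definition gmx_add X Y (f g : gmx X Y) : gmx X Y := fun x y => f x y + g x y.

Lemma column_finite_add X Y (f g : gmx X Y) :
  column_finite f -> column_finite g -> column_finite (gmx_add f g).
Proof.
move=> ff gf x; have [s _ sP] := ff x; have [t _ tP] := gf x.
exists (undup (s ++ t)); first exact: undup_uniq.
move=> y; rewrite /gmx_add mem_undup mem_cat.
have [->|/sP -> //] := eqVneq (f x y) 0.
by rewrite add0r => /tP ->; rewrite orbT.
Qed.

Lemma gmor_add X Y n (f g : gmx X Y) :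
  is_gmor n f -> is_gmor n g -> is_gmor n (gmx_add f g).
Proof.
move=> fn gn; apply: gmorP.
  exact: column_finite_add (gmor_fin fn) (gmor_fin gn).
move=> x y; rewrite /gmx_add; have [->|/fn.2 //] := eqVneq (f x y) 0.
by rewrite add0r => /gn.2.
Qed.

Lemma gmx_compDl X Y Z (f f' : gmx Y Z) (g : gmx X Y) : column_finite g ->
  gmx_comp (gmx_add f f') g = gmx_add (gmx_comp f g) (gmx_comp f' g).
Proof.
move=> gf; apply: gmxP => x z; have [s us sP] := gf x.
rewrite /gmx_add !(gmx_compE _ _ us sP) -big_split; apply: eq_bigr => y _.
exact: compDl.
Qed.

Lemma gmx_compDr X Y Z (f : gmx Y Z) (g g' : gmx X Y) :
  column_finite g -> column_finite g' ->
  gmx_comp f (gmx_add g g') = gmx_add (gmx_comp f g) (gmx_comp f g').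
Proof.
move=> gf gf'; apply: gmxP => x z.
have [s us sP] := gf x; have [t ut tP] := gf' x.
pose S := undup (s ++ t).
have sS y : g x y != 0 -> y \in S by move/sP; rewrite mem_undup mem_cat => ->.
have tS y : g' x y != 0 -> y \in S.
  by move/tP; rewrite mem_undup mem_cat => ->; rewrite orbT.
rewrite /gmx_add !(@gmx_compE _ _ _ _ _ _ _ S) ?undup_uniq //; last first.
  by move=> y; have [->|/sS //] := eqVneq (g x y) 0; rewrite add0r => /tS.
by rewrite -big_split; apply: eq_bigr => y _; apply: compDr.
Qed.

End Matrices.

(** * Composition of chain maps and transitivity of homotopy equivalence *)

Section Homotopy.
Variables (G : zmodType) (k : comPzRingType) (mu : sym_bichar G k).
Variable C : gmcat mu.
Implicit Types X Y Z : complex C.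

Lemma chain_mapE X Y (f : gmx X Y) : chain_map f ->
  gmx_comp (@cx_d _ _ _ _ Y) f = gmx_comp f (@cx_d _ _ _ _ X).
Proof. by move=> [_ E]; apply: gmxP. Qed.

Lemma chain_map_comp X Y Z (f : gmx Y Z) (g : gmx X Y) :
  chain_map f -> chain_map g -> chain_map (gmx_comp f g).
Proof.
move=> fc gc; have [f0 _] := fc; have [g0 _] := gc.
split=> [|x z]; first by rewrite -[0]addr0; apply: gmor_comp.
have ff := gmor_fin f0; have gf := gmor_fin g0.
have dX := gmor_fin (@cx_d_gmor _ _ _ _ X).
have dY := gmor_fin (@cx_d_gmor _ _ _ _ Y).
rewrite gmx_compA // (chain_mapE fc) -(gmx_compA _ dY gf) (chain_mapE gc).
by rewrite gmx_compA.
Qed.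

Lemma homotopicE X Y (f g : gmx X Y) : homotopic f g ->
  exists2 h : gmx X Y, is_gmor (-1) h &
  f = gmx_add g (gmx_add (gmx_comp (@cx_d _ _ _ _ Y) h)
                           (gmx_comp h (@cx_d _ _ _ _ X))).
Proof.
move=> [h h1 E]; exists h => //; apply: gmxP => x y.
by rewrite /gmx_add -E addrC subrK.
Qed.

(* With [f' f ~ 1] through [h] and [g' g ~ 1] through [h'], the homotopy for the
   composite is [h + f' h' f]. *)
Lemma homotopic_comp_id X Y Z (f : gmx X Y) (f' : gmx Y X)
    (g : gmx Y Z) (g' : gmx Z Y) :
  chain_map f -> chain_map f' -> chain_map g -> chain_map g' ->
  homotopic (gmx_comp f' f) (@gmx_id _ _ _ _ X) ->
  homotopic (gmx_comp g' g) (@gmx_id _ _ _ _ Y) ->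
  homotopic (gmx_comp (gmx_comp f' g') (gmx_comp g f)) (@gmx_id _ _ _ _ X).
Proof.
move=> fc fc' gc gc' /homotopicE[h hd hE] /homotopicE[l ld lE].
have [[f0 _] [f0' _] [g0 _] [g0' _]] := (And4 fc fc' gc gc').
have dX := cx_d_gmor X; have dY := cx_d_gmor Y.
have lfd : is_gmor (-1) (gmx_comp l f) by rewrite -[-1]add0r; apply: gmor_comp.
have fld : is_gmor (-1) (gmx_comp f' (gmx_comp l f)).
  by rewrite -[-1]addr0; apply: gmor_comp.
exists (gmx_add h (gmx_comp f' (gmx_comp l f))); first exact: gmor_add.
have E : gmx_comp (gmx_comp f' g') (gmx_comp g f)
   = gmx_add (@gmx_id _ _ _ _ X) (gmx_add
      (gmx_comp (@cx_d _ _ _ _ X) (gmx_add h (gmx_comp f' (gmx_comp l f))))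
      (gmx_comp (gmx_add h (gmx_comp f' (gmx_comp l f))) (@cx_d _ _ _ _ X))).
  rewrite -(gmx_compA f' (gmor_fin g0') (gmor_fin (gmor_comp g0 f0))).
  rewrite (gmx_compA g' (gmor_fin g0) (gmor_fin f0)) lE.
  rewrite !(gmx_compDl _ _ (gmor_fin f0)) gmx_comp1l; last exact: gmor_fin f0.
  (* Since [f] and [f'] commute with the differentials, [f' (d l + l d) f] becomes
     [d (f' l f) + (f' l f) d]. *)
  rewrite -(gmx_compA _ (gmor_fin ld) (gmor_fin f0)).
  rewrite -(gmx_compA _ (gmor_fin dY) (gmor_fin f0)) (chain_mapE fc).
  rewrite (gmx_compA l (gmor_fin f0) (gmor_fin dX)).
  have c1 := gmor_fin (gmor_comp dY lfd).
  have c2 := gmor_fin (gmor_comp lfd dX).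
  rewrite (gmx_compDr _ (gmor_fin f0) (column_finite_add c1 c2)).
  rewrite (gmx_compDr _ c1 c2) hE.
  rewrite (gmx_compA f' (gmor_fin dY) (gmor_fin lfd)) -(chain_mapE fc').
  rewrite -(gmx_compA _ (gmor_fin f0') (gmor_fin lfd)).
  rewrite (gmx_compA f' (gmor_fin lfd) (gmor_fin dX)).
  rewrite (gmx_compDr _ (gmor_fin hd) (gmor_fin fld)).
  rewrite (gmx_compDl _ _ (gmor_fin dX)).
  apply: gmxP => x y; rewrite /gmx_add -!addrA.
  by congr (_ + (_ + _)); rewrite addrCA.
by move=> x y; rewrite E /gmx_add addrC addKr.
Qed.

Lemma homotopy_equivalent_trans X Y Z :
  homotopy_equivalent X Y -> homotopy_equivalent Y Z ->
  homotopy_equivalent X Z.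
Proof.
move=> [f [f' [fc fc' H H']]] [g [g' [gc gc' K K']]].
exists (gmx_comp g f), (gmx_comp f' g'); split.
- exact: chain_map_comp.
- exact: chain_map_comp.
- exact: homotopic_comp_id.
(* The same lemma applies with the two equivalences reversed and in the opposite order. *)
- exact: homotopic_comp_id.
Qed.

End Homotopy.

(** * Signs, and the lattice over a disjoint union as a product of lattices *)

Section Sign.
Variable k : comPzRingType.

Lemma intsign0 : intsign k 0 = 1. Proof. exact: expr0. Qed.

(** The absolute value in [intsign] is not additive, hence an integer induction based on the
    one-step rule [intsignD1]. *)
Lemma intsignD m n : intsign k (m + n) = intsign k m * intsign k n.
Proof.
have S p : intsign k (p - 1) = - intsign k p.
  by rewrite -[in RHS](subrK 1 p) intsignD1 opprK.
elim/int_rec: n => [|n IH|n IH]; first by rewrite addr0 intsign0 mulr1.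
  by rewrite -addn1 PoszD addrA !intsignD1 IH mulrN.
by rewrite -addn1 PoszD opprD addrA !S IH mulrN.
Qed.

End Sign.

Section GlueLattice.
Variables (d d' : Order.disp_t) (I : finOrderType d) (J : finOrderType d').
Local Notation K := (ordsum I J).

Definition glue (r : lattice I) (s : lattice J) : lattice K :=
  [ffun c : K => match c with inl i => r i | inr j => s j end].

Lemma resl_glue r s : resl (glue r s) = r.
Proof. by apply/ffunP => i; rewrite !ffunE. Qed.

Lemma resr_glue r s : resr (glue r s) = s.
Proof. by apply/ffunP => i; rewrite !ffunE. Qed.

Lemma glueK (r : lattice K) : glue (resl r) (resr r) = r.
Proof. by apply/ffunP => -[i|j]; rewrite !ffunE. Qed.

Lemma eq_res (r s : lattice K) : resl r = resl s -> resr r = resr s -> r = s.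
Proof. by move=> rsl rsr; rewrite -(glueK r) rsl rsr glueK. Qed.

Lemma weight_res (r : lattice K) : weight r = weight (resl r) + weight (resr r).
Proof.
rewrite /weight big_sumType; congr (_ + _); apply: eq_bigr => i _;
by rewrite ffunE.
Qed.

End GlueLattice.

(** * Shifted degrees and the Koszul tensor product of matrices *)

Section TensorMatrices.
Variables (G : zmodType) (k : comPzRingType) (mu : sym_bichar G k).
Variable C : gmcat mu.

Definition pot (d : Order.disp_t) (I : finOrderType d) (A : polycomplex C I) :=
  potential (pc_psi A).

(** The equality [E] is arbitrary: proofs of equality between objects are irrelevant, so it can
    match whatever cast the tensor polycomplex carries. *)
Lemma tens_cast (x x' x'' y y' y'' : C) (e : x' = x'') (e' : y' = y'')
    (E : x' \ot y' = x'' \ot y'') (f : hom x x') (g : hom y y') :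
  hom_cast (H := @hom _ _ _ C) erefl e f \om
    hom_cast (H := @hom _ _ _ C) erefl e' g
  = hom_cast (H := @hom _ _ _ C) erefl E (f \om g).
Proof.
move: E; case: x'' / e; case: y'' / e' => E.
by symmetry; apply: castE.
Qed.

Section Normal.
Variables (d d' : Order.disp_t) (I : finOrderType d) (I' : finOrderType d').
Variables (A : polycomplex C I) (A' : polycomplex C I').

(* The objects [pc_ob A r] are regarded as shifted by [pot A r]: a component
   of degree [a] from [r] to [s] has shifted degree [a - pot A' s + pot A r],
   and the differentials have shifted degree 0. *)
Definition normal (f : gmx (tot_gsum A) (tot_gsum A')) :=
  forall r s, homdeg (pot A' s - pot A r) (f r s).

(** A part of degree [a] is multiplied by [mu u] of its shifted degree [a - pot A' s + pot A r], so
    normal matrices are fixed. *)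
Definition ntwist (u : G) (f : gmx (tot_gsum A) (tot_gsum A')) :
    gmx (tot_gsum A) (tot_gsum A') :=
  fun r s => mu u (pot A r - pot A' s) *: twist u (f r s).

Lemma ntwist_normal u f r s : normal f -> ntwist u f r s = f r s.
Proof.
move=> nf; rewrite /ntwist (twist_homdeg _ (nf _ _)) scalerA -bicharDr.
by rewrite addrA subrK subrr bichar0r scale1r.
Qed.

Lemma ntwist0 u f r s : f r s = 0 -> ntwist u f r s = 0.
Proof. by rewrite /ntwist => ->; rewrite twist0 scaler0. Qed.

End Normal.

Section NormalId.
Variables (d : Order.disp_t) (I : finOrderType d) (A : polycomplex C I).

Lemma normal_id : normal (@gmx_id _ _ _ _ (tot_gsum A)).
Proof.
move=> r s; have [<-|rs] := eqVneq r s; last first.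
  by rewrite gmx_id_neq //; apply: homdeg0.
by rewrite gmx_idxx subrr; apply: homdeg_id.
Qed.

(** The value of a cocycle on an edge is the difference of its potentials at the two ends. *)
Lemma normal_d : normal (@tot_d _ _ _ _ _ _ A).
Proof.
move=> r s; have [->|/tot_d_neq0[i ->]] := eqVneq (@tot_d _ _ _ _ _ _ A r s) 0.
  exact: homdeg0.
rewrite tot_dE.
have -> : pot A (r + unitv i) - pot A r = pc_psi A r (r + unitv i).
  by rewrite /pot (potentialD (pc_cocycle A) (adjacentD r i)) addrC addKr.
exact: pc_homdeg.
Qed.

End NormalId.

Section TensMx.
Variables (d1 d2 d1' d2' : Order.disp_t).
Variables (I : finOrderType d1) (J : finOrderType d2).
Variables (I' : finOrderType d1') (J' : finOrderType d2').
Variables (A : polycomplex C I) (B : polycomplex C J).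
Variables (A' : polycomplex C I') (B' : polycomplex C J').

(* Koszul rule for [f (x) g], where [g] has degree [n]: [g] moves past the
   shift of [pc_ob A (resl r)], and [f] past that of [pc_ob B' (resr s)]. *)
Definition tensmx (n : int) (f : gmx (tot_gsum A) (tot_gsum A'))
    (g : gmx (tot_gsum B) (tot_gsum B')) :
    gmx (tot_gsum (pc_tens A B)) (tot_gsum (pc_tens A' B')) :=
  fun r s => intsign k (n * weight (resl r)) *:
    (ntwist (pot B' (resr s)) f (resl r) (resl s) \om
     twist (pot A (resl r)) (g (resr r) (resr s))).

Lemma tensmx_neq0 n f g r s : tensmx n f g r s != 0 ->
  f (resl r) (resl s) != 0 /\ g (resr r) (resr s) != 0.
Proof.
move=> nz; split; apply: contraNneq nz => E; rewrite /tensmx.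
  by rewrite (ntwist0 _ E) tens0l scaler0.
by rewrite E twist0 tens0r scaler0.
Qed.

Lemma tensmx_gmor n f g i j : is_gmor i f -> is_gmor j g ->
  is_gmor (i + j) (tensmx n f g).
Proof.
move=> fi gj; apply: gmorP => [r|r s /tensmx_neq0[/fi.2 E /gj.2 E']].
  have [s _ sP] := gmor_fin fi (resl r); have [t _ tP] := gmor_fin gj (resr r).
  exists (undup [seq glue a b | a <- s, b <- t]); first exact: undup_uniq.
  move=> u /tensmx_neq0[/sP us /tP ut]; rewrite mem_undup -[u]glueK.
  by apply/allpairsP; exists (resl u, resr u).
by rewrite /= !weight_res; rewrite /= in E E'; rewrite E E' addrACA.
Qed.

Lemma tensmxDl n f f' g :
  tensmx n (gmx_add f f') g = gmx_add (tensmx n f g) (tensmx n f' g).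
Proof.
apply: gmxP => r s.
by rewrite /tensmx /gmx_add /ntwist twistD scalerDr tensDl scalerDr.
Qed.

Lemma tensmxDr n f g g' :
  tensmx n f (gmx_add g g') = gmx_add (tensmx n f g) (tensmx n f g').
Proof.
apply: gmxP => r s.
by rewrite /tensmx /gmx_add twistD tensDr scalerDr.
Qed.

End TensMx.

(** * Interchange law for tensor products of matrices *)

Section TensMxComp.
Variables (d1 d2 d1' d2' d1'' d2'' : Order.disp_t).
Variables (I : finOrderType d1) (J : finOrderType d2).
Variables (I' : finOrderType d1') (J' : finOrderType d2').
Variables (I'' : finOrderType d1'') (J'' : finOrderType d2'').
Variables (A : polycomplex C I) (B : polycomplex C J).
Variables (A' : polycomplex C I') (B' : polycomplex C J').
Variables (A'' : polycomplex C I'') (B'' : polycomplex C J'').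

Lemma tensmx_comp_entry (f : gmx (tot_gsum A') (tot_gsum A''))
    (g : gmx (tot_gsum B') (tot_gsum B''))
    (h : gmx (tot_gsum A) (tot_gsum A')) (l : gmx (tot_gsum B) (tot_gsum B'))
    x y z x' y' z' :
  normal h \/ normal g ->
  (ntwist (pot B'' z') f y z \om twist (pot A' y) (g y' z')) \oc
    (ntwist (pot B' y') h x y \om twist (pot A x) (l x' y'))
  = (ntwist (pot B'' z') f y z \oc ntwist (pot B'' z') h x y) \om
    (twist (pot A x) (g y' z') \oc twist (pot A x) (l x' y')).
Proof.
case=> [nh|ng].
  (* The degree of [h x y] is [pot A' y - pot A x], so interchange turns the twist of [g] by
     [pot A' y] into one by [pot A x]. *)
  rewrite !(ntwist_normal _ _ _ nh) (interchange_homdegl _ _ _ (nh x y)).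
  by rewrite -twistDu opprB subrK.
have gz := ng y' z'.
rewrite !(twist_homdeg _ gz) tensZr compZl (interchange_homdegr _ _ _ gz).
rewrite (compZl _ (g y' z')) tensZr; set b := pot B'' z' - _.
(* Interchange twists [h] by the degree [b] of [g], which moves its twist from [pot B' y'] to
   [pot B'' z']. The scalar left over accounts for the change from [pot A' y] to [pot A x] in the
   twist of [g]. *)
have -> : ntwist (pot B'' z') h x y
    = mu b (pot A x - pot A' y) *: twist b (ntwist (pot B' y') h x y).
  by rewrite /ntwist twistZ -twistDu scalerA -bicharDl !subrK.
rewrite compZr tensZl scalerA -(bicharN mu _ b) -bicharDl opprB.
by congr (mu _ _ *: _); rewrite addrC subrK.
Qed.

(** Shifted degrees add under composition: the potential at the intermediate point [y] cancels. *)
Lemma ntwist_comp u (f : gmx (tot_gsum A') (tot_gsum A''))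
    (h : gmx (tot_gsum A) (tot_gsum A')) x z s :
  uniq s -> (forall y, h x y != 0 -> y \in s) ->
  ntwist u (gmx_comp f h) x z
    = \sum_(y <- s) ntwist u f y z \oc ntwist u h x y.
Proof.
move=> us sP; rewrite {1}/ntwist (gmx_compE _ _ us sP) twist_sum scaler_sumr.
apply: eq_bigr => y _; rewrite /ntwist twist_comp compZl compZr scalerA.
by rewrite -bicharDr; congr (mu _ _ *: _); rewrite [RHS]addrC subrKA.
Qed.

(** The scalars are handled entry by entry in [tensmx_comp_entry]. The sign [intsign k (n * i)] is
    that of [g], counted with degree [n], passing [h] of degree [i]. *)
Lemma tensmx_comp n m i j (f : gmx (tot_gsum A') (tot_gsum A''))
    (g : gmx (tot_gsum B') (tot_gsum B''))
    (h : gmx (tot_gsum A) (tot_gsum A')) (l : gmx (tot_gsum B) (tot_gsum B'))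
    r t :
  is_gmor i h -> is_gmor j l -> normal h \/ normal g ->
  gmx_comp (tensmx n f g) (tensmx m h l) r t
    = intsign k (n * i) *: tensmx (n + m) (gmx_comp f h) (gmx_comp g l) r t.
Proof.
move=> hi lj nhg.
have [s us sP] := gmor_fin hi (resl r).
have [s' us' sP'] := gmor_fin lj (resr r).
have uss : uniq [seq glue a b | a <- s, b <- s'].
  apply: allpairs_uniq => // -[a b] [a' b'] _ _ /= E.
  by congr (_, _); [rewrite -(resl_glue a b) E resl_glue
                  | rewrite -(resr_glue a b) E resr_glue].
rewrite (@gmx_compE _ _ _ _ _ (tot_gsum (pc_tens A' B')) _ _ _ _ _ _ uss);
  last first.
  move=> u /tensmx_neq0[/sP us0 /sP' us1]; rewrite -[u]glueK.
  by apply/allpairsP; exists (resl u, resr u).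
rewrite /tensmx (ntwist_comp _ _ _ us sP) (gmx_compE _ _ us' sP') twist_sum.
rewrite scalerA tens_suml scaler_sumr big_allpairs_dep; apply: eq_bigr => y _.
rewrite tens_sumr scaler_sumr; apply: eq_bigr => y' _.
rewrite compZl compZr scalerA tensmx_comp_entry //.
rewrite resl_glue resr_glue twist_comp.
(* The weights of [resl r] and [y] are known to differ by [i] only where [h] is nonzero; elsewhere
   both terms vanish. *)
have [h0|hy] := eqVneq (h (resl r) y) 0.
  by rewrite (ntwist0 _ h0) comp0r tens0l !scaler0.
congr (_ *: _); rewrite -!intsignD; congr (intsign k _).
have /= -> := hi.2 _ _ hy.
by rewrite mulrDr mulrDl addrAC addrC.
Qed.

End TensMxComp.

(** * Identity and differential of a tensor product *)

Section TensD.
Variables (d d' : Order.disp_t) (I : finOrderType d) (J : finOrderType d').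
Variables (A : polycomplex C I) (B : polycomplex C J).

Lemma tensmx_id n :
  tensmx n (@gmx_id _ _ _ _ (tot_gsum A)) (@gmx_id _ _ _ _ (tot_gsum B))
  = fun r s => intsign k (n * weight (resl r)) *: gmx_id r s.
Proof.
apply: gmxP => r s; rewrite /tensmx ntwist_normal; last exact: normal_id.
congr (_ *: _); have [<-|rs] := eqVneq r s.
  by rewrite !gmx_idxx twist_id gm_tens_id.
rewrite (gmx_id_neq (X := tot_gsum (pc_tens A B)) rs).
have [E|E] := eqVneq (resl r) (resl s); last by rewrite gmx_id_neq // tens0l.
rewrite [gmx_id (X := tot_gsum B) (resr r) _]gmx_id_neq ?twist0 ?tens0r //.
by apply: contra_neq rs => /(eq_res E).
Qed.

(** Directions in [I] give the first summand and those in [J] the second. There [tens_coef] is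
    exactly the Koszul factor: the sign comes from the index 1, and the scalar from twisting the
    normal matrix [tot_d] of [B]. *)
Lemma tot_d_tens : @tot_d _ _ _ _ _ _ (pc_tens A B)
  = gmx_add (tensmx 0 (@tot_d _ _ _ _ _ _ A) (@gmx_id _ _ _ _ (tot_gsum B)))
            (tensmx 1 (@gmx_id _ _ _ _ (tot_gsum A)) (@tot_d _ _ _ _ _ _ B)).
Proof.
apply: gmxP => r s; rewrite /gmx_add {1}/tot_d big_sumType; congr (_ + _).
  rewrite /tensmx ntwist_normal; last exact: normal_d.
  rewrite mul0r intsign0 scale1r (twist_homdeg _ (normal_id B _ _)).
  have -> : mu (pot A (resl r)) (pot B (resr s) - pot B (resr r)) *:
      @gmx_id _ _ _ _ (tot_gsum B) (resr r) (resr s)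
      = @gmx_id _ _ _ _ (tot_gsum B) (resr r) (resr s).
    have [->|rs] := eqVneq (resr r) (resr s).
      by rewrite subrr bichar0r scale1r.
    by rewrite gmx_id_neq ?scaler0.
  rewrite /tot_d tens_suml; apply: eq_bigr => i _.
  (* A point [s] equals [r + unitv i] exactly when both restrictions match, so the tests on the two
     sides agree. *)
  rewrite /gmx_id; case: eqP => [e|ne].
    have el : resl r + unitv i = resl s by rewrite -e reslDl.
    have er : resr r = resr s by rewrite -e -resrDl.
    case: eqP => // {}el; case: eqP => // {}er.
    by rewrite /= cast_cast; symmetry; apply: tens_cast.
  case: eqP => [el|_]; last by rewrite tens0l.
  case: eqP => [er|_]; last by rewrite tens0r.
  by case: ne; apply: eq_res; rewrite -?reslDl -?resrDl.
rewrite /tensmx ntwist_normal; last exact: normal_id.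
rewrite mul1r (twist_homdeg _ (normal_d B _ _)) tensZr scalerA.
rewrite /tot_d tens_sumr scaler_sumr; apply: eq_bigr => j _.
rewrite /gmx_id; case: eqP => [e|ne].
  have el : resl r = resl s by rewrite -e -reslDr.
  have er : resr r + unitv j = resr s by rewrite -e resrDr.
  case: eqP => // {}el; case: eqP => // {}er.
  rewrite /= castZ cast_cast /tens_coef.
  have -> : pot B (resr s) - pot B (resr r)
      = pc_psi B (resr r) (resr r + unitv j).
    rewrite -[in LHS]er /pot (potentialD (pc_cocycle B) (adjacentD _ j)).
    by rewrite addrC addKr.
  by congr (_ *: _); symmetry; apply: tens_cast.
case: eqP => [el|_]; last by rewrite tens0l scaler0.
case: eqP => [er|_]; last by rewrite tens0r scaler0.
by case: ne; apply: eq_res; rewrite -?reslDr -?resrDr.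
Qed.

End TensD.

End TensorMatrices.

(** * Tensoring chain maps and homotopies with an identity *)

Section Functoriality.
Variables (G : zmodType) (k : comPzRingType) (mu : sym_bichar G k).
Variable C : gmcat mu.

Local Notation one A := (@gmx_id _ _ _ _ (tot_gsum A)).
Local Notation dd A := (@tot_d _ _ _ _ _ _ A).

Section Left.
Variables (d d1 d2 : Order.disp_t).
Variables (I : finOrderType d1) (I' : finOrderType d2) (J : finOrderType d).
Variables (A : polycomplex C I) (A' : polycomplex C I') (B : polycomplex C J).

(** The sign arises from [1 (x) d] passing [f]. Compared with [comp_tensl_d], the cross terms
    [f (x) d] agree for [j = 0], as chain maps require, and cancel for [j = -1], as homotopies
    require. *)
Lemma comp_d_tensl j (f : gmx (tot_gsum A) (tot_gsum A')) r s : is_gmor j f ->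
  gmx_comp (dd (pc_tens A' B)) (tensmx 0 f (one B)) r s
    = tensmx 0 (gmx_comp (dd A') f) (one B) r s
      + intsign k j *: tensmx 1 f (dd B) r s.
Proof.
move=> fj; have f1 := tensmx_gmor 0 fj (gmx_id_gmor (tot_gsum B)).
have i1 := gmx_id_gmor (tot_gsum B).
rewrite tot_d_tens (gmx_compDl _ _ (gmor_fin f1)) /gmx_add.
rewrite (tensmx_comp _ _ _ _ _ fj i1); last by right; apply: normal_id.
rewrite (tensmx_comp _ _ _ _ _ fj i1); last by right; apply: normal_d.
rewrite !gmx_comp1r (gmx_comp1l (gmor_fin fj)).
by rewrite mul0r intsign0 scale1r mul1r !addr0.
Qed.

Lemma comp_tensl_d j (f : gmx (tot_gsum A) (tot_gsum A')) r s : is_gmor j f ->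
  gmx_comp (tensmx 0 f (one B)) (dd (pc_tens A B)) r s
    = tensmx 0 (gmx_comp f (dd A)) (one B) r s + tensmx 1 f (dd B) r s.
Proof.
move=> fj; have i1 := gmx_id_gmor (tot_gsum B).
have i2 := gmx_id_gmor (tot_gsum A).
have dA := tot_d_gmor A; have dB := tot_d_gmor B.
rewrite tot_d_tens (gmx_compDr _ (gmor_fin (tensmx_gmor 0 dA i1))
  (gmor_fin (tensmx_gmor 1 i2 dB))).
rewrite /gmx_add (tensmx_comp _ _ _ _ _ dA i1); last by right; apply: normal_id.
rewrite (tensmx_comp _ _ _ _ _ i2 dB); last by right; apply: normal_id.
rewrite !gmx_comp1r (gmx_comp1l (gmor_fin dB)).
by rewrite !mul0r intsign0 !scale1r !add0r.
Qed.

Lemma chain_map_tensl (f : gmx (Tot A) (Tot A')) : chain_map f ->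
  @chain_map _ _ _ _ (Tot (pc_tens A B)) (Tot (pc_tens A' B))
    (tensmx 0 f (one B)).
Proof.
move=> fc; have [f0 _] := fc; split.
  exact: (tensmx_gmor 0 f0 (gmx_id_gmor _)).
move=> r s; rewrite (comp_d_tensl _ _ f0) (comp_tensl_d _ _ f0).
by rewrite intsign0 scale1r (chain_mapE fc).
Qed.

Lemma homotopic_tensl (f g : gmx (Tot A) (Tot A')) : homotopic f g ->
  @homotopic _ _ _ _ (Tot (pc_tens A B)) (Tot (pc_tens A' B))
    (tensmx 0 f (one B)) (tensmx 0 g (one B)).
Proof.
move=> /homotopicE[h h1 ->]; exists (tensmx 0 h (one B)).
  exact: (tensmx_gmor 0 h1 (gmx_id_gmor _)).
move=> r s; rewrite (comp_d_tensl _ _ h1) (comp_tensl_d _ _ h1).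
rewrite !tensmxDl /gmx_add (addrC (tensmx 0 g _ _ _)) addrK.
by rewrite /intsign expr1 scaleN1r addrACA addNr addr0.
Qed.

End Left.

Section Right.
Variables (d d1 d2 : Order.disp_t).
Variables (I : finOrderType d) (J : finOrderType d1) (J' : finOrderType d2).
Variables (A : polycomplex C I) (B : polycomplex C J) (B' : polycomplex C J').

Lemma comp_d_tensr j (g : gmx (tot_gsum B) (tot_gsum B')) r s : is_gmor j g ->
  gmx_comp (dd (pc_tens A B')) (tensmx j (one A) g) r s
    = tensmx j (dd A) g r s
      + tensmx (1 + j) (one A) (gmx_comp (dd B') g) r s.
Proof.
move=> gj; have i1 := gmx_id_gmor (tot_gsum A).
have f1 := tensmx_gmor j i1 gj.
rewrite tot_d_tens (gmx_compDl _ _ (gmor_fin f1)) /gmx_add.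
rewrite (tensmx_comp _ _ _ _ _ i1 gj); last by right; apply: normal_id.
rewrite (tensmx_comp _ _ _ _ _ i1 gj); last by right; apply: normal_d.
rewrite !gmx_comp1r (gmx_comp1l (gmor_fin gj)).
by rewrite !mulr0 intsign0 !scale1r add0r.
Qed.

(** Here [1 (x) g] passes [d (x) 1], which produces the sign; in [comp_d_tensr] the factor being
    passed is an identity of degree 0. *)
Lemma comp_tensr_d j (g : gmx (tot_gsum B) (tot_gsum B')) r s : is_gmor j g ->
  gmx_comp (tensmx j (one A) g) (dd (pc_tens A B)) r s
    = intsign k j *: tensmx j (dd A) g r s
      + tensmx (1 + j) (one A) (gmx_comp g (dd B)) r s.
Proof.
move=> gj; have i1 := gmx_id_gmor (tot_gsum B).
have i2 := gmx_id_gmor (tot_gsum A).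
have dA := tot_d_gmor A; have dB := tot_d_gmor B.
rewrite tot_d_tens (gmx_compDr _ (gmor_fin (tensmx_gmor 0 dA i1))
  (gmor_fin (tensmx_gmor 1 i2 dB))).
(* As [g] is arbitrary here, normality has to come from the [A] factor of the differential. *)
rewrite /gmx_add (tensmx_comp _ _ _ _ _ dA i1); last by left; apply: normal_d.
rewrite (tensmx_comp _ _ _ _ _ i2 dB); last by left; apply: normal_id.
rewrite !gmx_comp1r (gmx_comp1l (gmor_fin dA)).
by rewrite mulr0 mulr1 intsign0 scale1r addr0 [1 + j]addrC.
Qed.

Lemma chain_map_tensr (g : gmx (Tot B) (Tot B')) : chain_map g ->
  @chain_map _ _ _ _ (Tot (pc_tens A B)) (Tot (pc_tens A B'))
    (tensmx 0 (one A) g).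
Proof.
move=> gc; have [g0 _] := gc; split.
  exact: (tensmx_gmor 0 (gmx_id_gmor _) g0).
move=> r s; rewrite (comp_d_tensr _ _ g0) (comp_tensr_d _ _ g0).
by rewrite intsign0 scale1r (chain_mapE gc).
Qed.

Lemma homotopic_tensr (f g : gmx (Tot B) (Tot B')) : homotopic f g ->
  @homotopic _ _ _ _ (Tot (pc_tens A B)) (Tot (pc_tens A B'))
    (tensmx 0 (one A) f) (tensmx 0 (one A) g).
Proof.
(* The index is the degree of [h]: the terms [d (x) h] then cancel, and the others have index
   [1 + -1 = 0], like the given maps. *)
move=> /homotopicE[h h1 ->]; exists (tensmx (-1) (one A) h).
  exact: (tensmx_gmor (-1) (gmx_id_gmor _) h1).
move=> r s; rewrite (comp_d_tensr _ _ h1) (comp_tensr_d _ _ h1).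
rewrite !tensmxDr /gmx_add (addrC (tensmx 0 _ g _ _)) addrK.
by rewrite /intsign expr1 scaleN1r addrACA subrr add0r subrr.
Qed.

End Right.

Lemma tensmx_one (d d' : Order.disp_t) (I : finOrderType d)
    (J : finOrderType d') (A : polycomplex C I) (B : polycomplex C J) :
  tensmx 0 (one A) (one B) = one (pc_tens A B).
Proof.
by rewrite tensmx_id; apply: gmxP => r s; rewrite mul0r intsign0 scale1r.
Qed.

Lemma tensl_comp (d1 d2 d3 d : Order.disp_t) (I1 : finOrderType d1)
    (I2 : finOrderType d2) (I3 : finOrderType d3) (J : finOrderType d)
    (A1 : polycomplex C I1) (A2 : polycomplex C I2) (A3 : polycomplex C I3)
    (B : polycomplex C J) (f : gmx (tot_gsum A2) (tot_gsum A3))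
    (g : gmx (tot_gsum A1) (tot_gsum A2)) : is_gmor 0 g ->
  gmx_comp (tensmx 0 f (one B)) (tensmx 0 g (one B))
    = tensmx 0 (gmx_comp f g) (one B).
Proof.
move=> g0; apply: gmxP => r s.
rewrite (tensmx_comp _ _ _ _ _ g0 (gmx_id_gmor _)); last first.
  by right; apply: normal_id.
by rewrite gmx_comp1r mul0r intsign0 scale1r.
Qed.

Lemma tensr_comp (d1 d2 d3 d : Order.disp_t) (J1 : finOrderType d1)
    (J2 : finOrderType d2) (J3 : finOrderType d3) (I : finOrderType d)
    (B1 : polycomplex C J1) (B2 : polycomplex C J2) (B3 : polycomplex C J3)
    (A : polycomplex C I) (f : gmx (tot_gsum B2) (tot_gsum B3))
    (g : gmx (tot_gsum B1) (tot_gsum B2)) : is_gmor 0 g ->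
  gmx_comp (tensmx 0 (one A) f) (tensmx 0 (one A) g)
    = tensmx 0 (one A) (gmx_comp f g).
Proof.
move=> g0; apply: gmxP => r s.
rewrite (tensmx_comp _ _ _ _ _ (gmx_id_gmor _) g0); last first.
  by left; apply: normal_id.
by rewrite gmx_comp1r mul0r intsign0 scale1r.
Qed.

Lemma hequiv_tensl (d d1 d2 : Order.disp_t) (I : finOrderType d1)
    (I' : finOrderType d2) (J : finOrderType d) (A : polycomplex C I)
    (A' : polycomplex C I') (B : polycomplex C J) : A ≃ A' -> A ⊗ B ≃ A' ⊗ B.
Proof.
move=> [f [g [fc gc /(homotopic_tensl B) H /(homotopic_tensl B) H']]].
(* The tensored homotopy relates the images of the composite and of the identity; functoriality
   makes these a composite and an identity. *)
rewrite -(tensl_comp _ _ fc.1) tensmx_one in H.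
rewrite -(tensl_comp _ _ gc.1) tensmx_one in H'.
exists (tensmx 0 f (one B)), (tensmx 0 g (one B)).
by split=> //; apply: chain_map_tensl.
Qed.

Lemma hequiv_tensr (d d1 d2 : Order.disp_t) (I : finOrderType d)
    (J : finOrderType d1) (J' : finOrderType d2) (A : polycomplex C I)
    (B : polycomplex C J) (B' : polycomplex C J') : B ≃ B' -> A ⊗ B ≃ A ⊗ B'.
Proof.
move=> [f [g [fc gc /(homotopic_tensr A) H /(homotopic_tensr A) H']]].
rewrite -(tensr_comp _ _ fc.1) tensmx_one in H.
rewrite -(tensr_comp _ _ gc.1) tensmx_one in H'.
exists (tensmx 0 (one A) f), (tensmx 0 (one A) g).
by split=> //; apply: chain_map_tensr.
Qed.

End Functoriality.

Theorem theorem5p13 (G : zmodType) (k : comPzRingType) (mu : sym_bichar G k)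
    (C : gmcat mu) (d1 d2 d1' d2' : Order.disp_t)
    (I1 : finOrderType d1) (I2 : finOrderType d2)
    (J1 : finOrderType d1') (J2 : finOrderType d2')
    (A1 : polycomplex C I1) (A2 : polycomplex C I2)
    (B1 : polycomplex C J1) (B2 : polycomplex C J2) :
  A1 ≃ B1 -> A2 ≃ B2 -> A1 ⊗ A2 ≃ B1 ⊗ B2.
Proof.
(* The intermediate polycomplex is [B1 ⊗ A2]. *)
move=> /(hequiv_tensl A2) H1 /(hequiv_tensr B1) H2.
exact: homotopy_equivalent_trans H1 H2.
Qed.
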